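(* Let $G=(V,E,m,\mu)$ be a complete weighted graph satisfying the curvature dimension condition $\mathrm{CD}(K,\infty)$ for some $K\in\mathbb{R}$. Suppose that the measure $m$ is non-degenerate, i.e. $\inf_{x\in V}m(x)>0$. Then $G$ is stochastically complete.
   Context: Weighted graphs: $(V,E)$ is a (finite or infinite) undirected, connected, locally finite graph (every vertex has finitely many neighbors; self-loops are allowed); $x\sim y$ means $(x,y)\in E$. $\mu:E\to(0,\infty)$, $(x,y)\mapsto\mu_{xy}$, is symmetric and extended by $\mu_{xy}=0$ if $x\not\sim y$; $m:V\to(0,\infty)$ is a measure on $V$. The quadruple $G=(V,E,m,\mu)$ is called a weighted graph. $C_0(V)$ is the set of finitely supported functions $V\to\mathbb{R}$; $\ell^p_m=\ell^p(V,m)$. Formal Laplacian, for all $f:V\to\mathbb{R}$: $\Delta f(x)=\frac{1}{m(x)}\sum_{y}\mu_{xy}(f(y)-f(x))$. $\Gamma$-calculus: $\Gamma(f,g)(x)=\frac12(\Delta(fg)-f\Delta g-g\Delta f)(x)=\frac{1}{2m(x)}\sum_y\mu_{xy}(f(y)-f(x))(g(y)-g(x))$, $\Gamma(f)=\Gamma(f,f)$; $\Gamma_2(f)=\frac12\Delta\Gamma(f)-\Gamma(f,\Delta f)$. $\mathrm{CD}(K,\infty)$: $\Gamma_2(f)(x)\ge K\Gamma(f)(x)$ for all $f:V\to\mathbb{R}$ and all $x\in V$. Complete graph: there is a nondecreasing sequence $\{\eta_k\}_{k=1}^\infty\subset C_0(V)$ with $\lim_{k\to\infty}\eta_k=\mathds{1}$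 pointwise ($\mathds{1}$ the constant function $1$) and $\Gamma(\eta_k)\le\frac1k$ on $V$ for every $k$. Heat semigroup: $Q^{(D)}(f,g)=\frac12\sum_{x,y\in V}\mu_{xy}(f(y)-f(x))(g(y)-g(x))$ with domain $D(Q^{(D)})$ the completion of $C_0(V)$ under $\|f\|_Q=\left(\|f\|_{\ell^2_m}^2+\frac12\sum_{x,y}\mu_{xy}(f(y)-f(x))^2\right)^{1/2}$ is a Dirichlet form on $\ell^2_m$. Its generator is the self-adjoint operator $L^{(D)}$ on $\ell^2_m$ with $-L^{(D)}\ge0$ and $Q^{(D)}(f,g)=\langle(-L^{(D)})^{1/2}f,(-L^{(D)})^{1/2}g\rangle$; it acts as $\Delta$ on its domain. $P_t^{(D)}=e^{tL^{(D)}}$ is the associated semigroup on $\ell^2_m$, which extends to $\ell^p_m$ for all $p\in[1,\infty]$ (explicitly, $P_t^{(D)}f(x)=\sum_y p_t(x,y)f(y)m(y)$ with heat kernel $p_t(x,y)=m(y)^{-1}(P_t^{(D)}\delta_y)(x)$, where $\delta_y$ is the indicator function of $\{y\}$). Stochastically complete: $P_t^{(D)}\mathds{1}=\mathds{1}$ for all $t>0$. *)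

(* Defs.v *)
From HB Require Import structures.
From mathcomp Require Import all_boot all_order all_algebra.
From mathcomp Require Import all_classical all_reals all_analysis.

Set Implicit Arguments.
Unset Strict Implicit.
Unset Printing Implicit Defensive.

Import Order.TTheory GRing.Theory Num.Theory.
Import numFieldNormedType.Exports.

Local Open Scope classical_set_scope.
Local Open Scope ring_scope.

(* Sum of a real family over an arbitrary index set, as the sum of the positive
   parts minus the sum of the negative parts. It is the usual value when the
   family is summable (or when one of the two sums is finite); if both are
   infinite the value is -oo, by the convention on subtraction in \bar R. *)
Definition sumE (R : realType) (T : choiceType) (a : T -> R) : \bar R :=
  (\esum_(i in [set: T]) ((EFin \o a)^\+ i)
   - \esum_(i in [set: T]) ((EFin \o a)^\- i))%E.

Record weighted_graph (R : realType) (V : choiceType) := WeightedGraph {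
  edge : rel V;
  mu : V -> V -> R;
  m : V -> R;
  edge_sym : forall x y, edge x y = edge y x;
  edge_connected : forall x y, exists p, path edge x p /\ last x p = y;
  edge_locally_finite : forall x, finite_set [set y | edge x y];
  mu_sym : forall x y, mu x y = mu y x;
  mu_gt0 : forall x y, edge x y -> 0 < mu x y;
  mu_eq0 : forall x y, ~~ edge x y -> mu x y = 0;
  m_gt0 : forall x, 0 < m x }.

Section weighted_graph_calculus.
Variables (R : realType) (V : choiceType) (G : weighted_graph R V).
Implicit Types f g h : V -> R.

Definition finitely_supported f := finite_set [set x | f x != 0].

(* The terms with y not adjacent to x vanish because mu x y = 0. *)
Definition Lap f (x : V) : R :=
  (m G x)^-1 * \sum_(y \in [set y | edge G x y]) (mu G x y * (f y - f x)).

Definition Gam f g (x : V) : R :=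
  2^-1 * (Lap (f \* g) x - f x * Lap g x - g x * Lap f x).

Definition Gam2 f (x : V) : R :=
  2^-1 * Lap (Gam f f) x - Gam f (Lap f) x.

Definition CD (K : R) := forall f x, K * Gam f f x <= Gam2 f x.

(* eta k is the (k+1)-st function of the sequence indexed from 1. *)
Definition complete_graph := exists eta : nat -> V -> R,
  [/\ forall k, finitely_supported (eta k),
      forall x, nondecreasing_seq (eta ^~ x),
      forall x, eta k x @[k --> \oo] --> (1 : R)
    & forall k x, Gam (eta k) (eta k) x <= k.+1%:R^-1].

Definition nondegenerate_measure :=
  (0 < ereal_inf (range (fun x => (m G x)%:E)))%E.

Definition sqnorm f : \bar R :=
  \esum_(x in [set: V]) (f x ^+ 2 * m G x)%:E.

Definition ell2 : set (V -> R) := [set f | (sqnorm f < +oo)%E].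

Definition inner f g : R := fine (sumE (fun x => f x * g x * m G x)).

Definition energy f : \bar R :=
  (2^-1%:E * \esum_(p in [set: V * V])
     (mu G p.1 p.2 * (f p.2 - f p.1) ^+ 2)%:E)%E.

Definition sqnormQ f : \bar R := (sqnorm f + energy f)%E.

Definition formQ f g : R :=
  2^-1 * fine (sumE (fun p : V * V =>
    mu G p.1 p.2 * (f p.2 - f p.1) * (g p.2 - g p.1))).

(* The completion of the finitely supported functions under the form norm,
   realized inside ell2 as their closure for that norm. *)
Definition domQ : set (V -> R) := [set f | ell2 f /\
  exists u : nat -> V -> R, (forall n, finitely_supported (u n)) /\
    sqnormQ (u n \- f) @[n --> \oo] --> 0%E].

(* Unbounded operators on ell2; only the values of [act] on [dom] matter. *)
Record operator := Operator {
  dom : set (V -> R);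
  act : (V -> R) -> V -> R }.

Definition linear_operator (A : operator) :=
  [/\ dom A `<=` ell2,
      forall f, dom A f -> ell2 (act A f),
      dom A (fun=> 0)
    & forall (a : R) f g, dom A f -> dom A g ->
        dom A (fun x => a * f x + g x) /\
        act A (fun x => a * f x + g x) = (fun x => a * act A f x + act A g x)].

Definition densely_defined (A : operator) :=
  forall f, ell2 f -> forall e : R, 0 < e ->
    exists2 g, dom A g & (sqnorm (f \- g)%R < e%:E)%E.

(* The last clause says that A coincides with its adjoint: the left-hand side
   of the equivalence states that f is in the domain of the adjoint of A, which
   maps f to h. *)
Definition self_adjoint (A : operator) :=
  [/\ linear_operator A, densely_defined A
    & forall f h, ell2 f -> ell2 h ->
        (forall g, dom A g -> inner (act A g) f = inner g h) <->
        (dom A f /\ act A f = h)].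

Definition nonnegative_operator (A : operator) :=
  forall f, dom A f -> 0 <= inner (act A f) f.

Definition opp_operator (A : operator) : operator :=
  Operator (dom A) (fun f x => - act A f x).

(* S is the nonnegative self-adjoint square root of A, with dom (S o S) equal
   to dom A. *)
Definition sqrt_operator (S A : operator) :=
  [/\ self_adjoint S, nonnegative_operator S,
      forall f, dom A f <-> (dom S f /\ dom S (act S f))
    & forall f, dom A f -> act S (act S f) = act A f].

Definition dirichlet_generator (L : operator) :=
  [/\ self_adjoint L, nonnegative_operator (opp_operator L)
    & exists S, [/\ sqrt_operator S (opp_operator L), dom S = domQ
        & forall f g, domQ f -> domQ g ->
            formQ f g = inner (act S f) (act S g)]].

(* P is (t |-> e^(tL)), i.e. the strongly continuous semigroup of bounded
   operators on ell2 whose infinitesimal generator is L. *)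
Definition exp_semigroup (L : operator) (P : R -> (V -> R) -> V -> R) :=
  [/\ forall t, 0 <= t ->
        linear_operator (Operator ell2 (P t)) /\
        exists C : R, forall f, ell2 f -> (sqnorm (P t f) <= C%:E * sqnorm f)%E,
      forall f, ell2 f -> P 0 f = f,
      forall s t f, 0 <= s -> 0 <= t -> ell2 f -> P (s + t) f = P s (P t f),
      forall f, ell2 f -> sqnorm (P t f \- f) @[t --> 0^'+] --> 0%E
    & forall f h, ell2 f -> ell2 h ->
        (sqnorm (fun x => t^-1 * (P t f x - f x) - h x) @[t --> 0^'+] --> 0%E)
        <-> (dom L f /\ act L f = h)].

Definition heat_semigroup (P : R -> (V -> R) -> V -> R) :=
  exists2 L, dirichlet_generator L & exp_semigroup L P.

Definition heat_kernel (P : R -> (V -> R) -> V -> R) (t : R) (x y : V) : R :=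
  (m G y)^-1 * P t (\1_[set y]) x.

(* The extension of the semigroup beyond ell2, through the heat kernel. *)
Definition heat_extension (P : R -> (V -> R) -> V -> R) (t : R) f (x : V)
    : \bar R :=
  sumE (fun y => heat_kernel P t x y * f y * m G y).

(* The heat semigroup exists and is determined by G on ell2 (self-adjoint
   L <= 0), so the quantification over P only gives it a name. *)
Definition stochastically_complete :=
  forall P, heat_semigroup P ->
  forall t : R, 0 < t -> forall x, heat_extension P t (cst 1) x = 1%E.

End weighted_graph_calculus.

(* Main.v *)
(** Fix a heat semigroup P_t with generator L and a cutoff sequence eta_k. Since m >= c > 0,
    a function of finite energy has both |f| and Gamma(f) vanishing at infinity, and for f in
    dom L this holds uniformly for P_t f with t in a compact interval, because t |-> P_t f is
    uniformly continuous in the form norm. Hence every spatial supremum that matters is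
    attained, and the parabolic maximum principle applies directly.

    Applied to -P_t(1_y) it gives positivity. Applied to Gamma(P_t f) - B e^{2|K|t}, whose time
    derivative is controlled by CD(K,oo) through
      d/dt Gamma(u) = 2 Gamma(u, Lap u) <= Lap Gamma(u) - 2 K Gamma(u),
    it gives Gamma(P_t eta_k) <= e^{2|K|t}/k. Therefore d/dt P_t eta_k = Lap (P_t eta_k) tends to 0,
    locally uniformly in t and pointwise in x, so P_t eta_k(x) -> lim eta_k(x) = 1; writing
    P_t eta_k(x) as a sum of eta_k(y) P_t(1_y)(x) over y and using monotonicity of eta_k finishes
    the proof.

    Strong continuity is only assumed at 0 and boundedness only for each fixed t, so local
    uniform boundedness of P_t is first obtained by a nested balls argument in l^2. *)
Require Import Defs.
From mathcomp Require Import all_boot all_order all_algebra.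
From mathcomp Require Import all_classical all_reals all_analysis.
From mathcomp Require Import finmap ring lra.

Set Implicit Arguments.
Unset Strict Implicit.
Unset Printing Implicit Defensive.

Import Order.TTheory GRing.Theory Num.Theory.
Import numFieldNormedType.Exports.

Local Open Scope classical_set_scope.
Local Open Scope ring_scope.

(** * Sums of real families over arbitrary index sets *)

Section esum_real.
Variables (R : realType) (T : choiceType).
Implicit Types (a b : T -> R) (c e : R) (r s : seq T).

Lemma esum_le_fin a c : (forall r, uniq r -> \sum_(i <- r) a i <= c) ->
  (\esum_(i in [set: T]) (a i)%:E <= c%:E)%E.
Proof.
move=> ac; apply: ge_ereal_sup => _ [X [finX _]] <-.
by rewrite fsbig_finite// sumEFin lee_fin ac.
Qed.

Lemma sum_le_esum a c r : (forall i, 0 <= a i) ->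
  (\esum_(i in [set: T]) (a i)%:E <= c%:E)%E -> uniq r ->
  \sum_(i <- r) a i <= c.
Proof.
move=> a0 ac ur; rewrite -lee_fin -sumEFin (le_trans _ ac)//.
apply: esum_ge; exists [set` r]; first by split => //; exact: finite_seq.
by rewrite -fsbig_seq.
Qed.

Lemma le_term_esum a c i : (forall i, 0 <= a i) ->
  (\esum_(i in [set: T]) (a i)%:E <= c%:E)%E -> a i <= c.
Proof.
move=> a0 ac; rewrite -(big_seq1 +%R i a).
exact: sum_le_esum.
Qed.

(** A finite set whose sum comes within [e] of the supremum leaves no room for a further term larger
    than [e]. *)
Lemma esum_tail a c e : (forall i, 0 <= a i) ->
  (\esum_(i in [set: T]) (a i)%:E <= c%:E)%E -> 0 < e ->
  exists s, forall i, i \notin s -> a i <= e.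
Proof.
move=> a0 ac e0.
have Efin : (\esum_(i in [set: T]) (a i)%:E)%E \is a fin_num.
  rewrite fin_numElt (le_lt_trans ac) ?ltry// andbT (lt_le_trans (ltNyr 0))//.
  by apply: esum_ge0 => i _; rewrite lee_fin.
have [_ [X [finX _] <-]] := ub_ereal_sup_adherent e0 Efin.
rewrite -/(esum _ _) fsbig_finite//= => aX.
exists (fset_set X) => i iX.
have : (\sum_(j <- i :: fset_set X) (a j)%:E <= \esum_(j in [set: T]) (a j)%:E)%E.
  apply: esum_ge; exists [set` i :: fset_set X].
    by split => //; exact: finite_seq.
  by rewrite -fsbig_seq//= iX fset_uniq.
rewrite -(fineK Efin) in aX *.
by move: aX; rewrite big_cons sumEFin -!EFinD lee_fin lte_fin; lra.
Qed.

Lemma sumE_finite a r : uniq r -> (forall i, i \notin r -> a i = 0) ->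
  sumE a = (\sum_(i <- r) a i)%:E.
Proof.
(* Nonnegative families first; the positive and negative parts of [a] are then treated
   separately. *)
move=> ur ar; have esumr (b : T -> R) : (forall i, 0 <= b i) ->
    (forall i, i \notin r -> b i = 0) ->
    (\esum_(i in [set: T]) (b i)%:E = (\sum_(i <- r) b i)%:E)%E.
  move=> b0 br; apply/eqP; rewrite eq_le; apply/andP; split.
    apply: esum_le_fin => s us; rewrite (bigID (mem r))/= [X in _ + X]big1 ?addr0; last first.
      by move=> i /br.
    rewrite -big_filter; apply: (@le_trans _ _ (\sum_(i <- r | i \in s) b i)).
      rewrite -(big_filter r) le_eqVlt; apply/orP; left; apply/eqP/perm_big.
      by apply: uniq_perm; rewrite ?filter_uniq// => i; rewrite !mem_filter andbC.
    by rewrite [leRHS](bigID (mem s))/= lerDl sumr_ge0.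
  by apply: esum_ge; exists [set` r]; [split => //; exact: finite_seq|rewrite -fsbig_seq// sumEFin].
rewrite /sumE.
rewrite (eq_esum (b := fun i => (Num.max (a i) 0)%:E)); last first.
  by move=> i _; rewrite funeposE/= EFin_max.
rewrite [X in (_ - X)%E](eq_esum (b := fun i => (Num.max (- a i) 0)%:E)); last first.
  by move=> i _; rewrite funenegE/= EFin_max.
rewrite !esumr.
- rewrite -EFinB -sumrB; congr EFin; apply: eq_bigr => i _.
  by have [|] := ltP (a i) 0; have [|] := ltP (- a i) 0; lra.
- by move=> i; rewrite le_max lexx orbT.
- by move=> i /ar ->; rewrite oppr0 maxxx.
- by move=> i; rewrite le_max lexx orbT.
- by move=> i /ar ->; rewrite maxxx.
Qed.

Lemma sumE_ge0E a : (forall i, 0 <= a i) ->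
  sumE a = (\esum_(i in [set: T]) (a i)%:E)%E.
Proof.
move=> a0; rewrite /sumE [X in (_ - X)%E]esum1 ?sube0.
  by apply: eq_esum => i _; rewrite funeposE/= -EFin_max max_l.
by move=> i _; rewrite funenegE/= -EFin_max max_r// oppr_le0.
Qed.

Lemma fine_sumE_le a b c : (forall i, a i <= b i) -> (forall i, 0 <= b i) ->
  (\esum_(i in [set: T]) (b i)%:E <= c%:E)%E -> fine (sumE a) <= c.
Proof.
move=> ab b0 bc; have c0 : 0 <= c.
  by rewrite -lee_fin (le_trans _ bc)// esum_ge0// => i _; rewrite lee_fin.
have : (sumE a <= c%:E)%E.
  rewrite /sumE -[leRHS]sube0; apply: leeB; last first.
    by apply: esum_ge0 => i _; rewrite funenegE/= le_max lexx orbT.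
  apply: le_trans bc; apply: le_esum => i _.
  by rewrite funeposE/= -EFin_max lee_fin ge_max ab b0.
(* At [-oo], [fine] returns 0, and [0 <= c] settles this case. *)
by case: (sumE a) => //=; rewrite ?leye_eq.
Qed.

End esum_real.

Lemma indic1E (R : realType) (T : choiceType) (x y : T) :
  \1_[set y] x = (x == y)%:R :> R.
Proof.
rewrite indicE; congr (_%:R); congr nat_of_bool.
by apply/idP/eqP => [|->]; rewrite in_setE.
Qed.

(** * Laplacian, Gamma calculus, and Green's formula against indicators *)

Section graph_calculus.
Variables (R : realType) (V : choiceType) (G : weighted_graph R V).
Implicit Types (f g : V -> R) (x y : V).
Local Notation m := (m G).
Local Notation mu := (mu G).
Local Notation Lap := (Lap G).
Local Notation Gam := (Gam G).

Definition nbs x : seq V := enum_fset (fset_set [set y | edge G x y]).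

Definition half_degree x : R := 2^-1 * (m x)^-1 * \sum_(y <- nbs x) mu x y.

Lemma nbs_uniq x : uniq (nbs x).
Proof. exact: fset_uniq. Qed.

Lemma mem_nbs x y : (y \in nbs x) = edge G x y.
Proof.
by rewrite -[LHS]/(y \in fset_set _) in_fset_set ?mem_setE//; exact: edge_locally_finite.
Qed.

Lemma mu_ge0 x y : 0 <= mu x y.
Proof.
have [/mu_gt0/ltW//|/mu_eq0->//] := boolP (edge G x y).
Qed.

Lemma LapE f x :
  Lap f x = (m x)^-1 * \sum_(y <- nbs x) mu x y * (f y - f x).
Proof. by rewrite /Defs.Lap fsbig_finite//; exact: edge_locally_finite. Qed.

Lemma GamE f g x : Gam f g x =
  2^-1 * (m x)^-1 * \sum_(y <- nbs x) mu x y * ((f y - f x) * (g y - g x)).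
Proof.
rewrite /Defs.Gam !LapE -mulrA; congr (_ * _).
rewrite 2!(mulrCA _ (m x)^-1) -2!mulrBr; congr (_ * _).
rewrite !mulr_sumr -!sumrB; apply: eq_bigr => y _ /=.
by ring.
Qed.

Lemma Lap_linear (a : R) f g x :
  Lap (fun y => a * f y + g y) x = a * Lap f x + Lap g x.
Proof.
rewrite !LapE mulrCA -mulrDr; congr (_ * _).
by rewrite mulr_sumr -big_split/=; apply: eq_bigr => y _; ring.
Qed.

Lemma LapN f x : Lap (fun y => - f y) x = - Lap f x.
Proof.
rewrite !LapE -mulrN -sumrN; congr (_ * _).
by apply: eq_bigr => y _; ring.
Qed.

Lemma Lap_le0_max f x : (forall y, f y <= f x) -> Lap f x <= 0.
Proof.
move=> fx; rewrite LapE mulr_ge0_le0 ?invr_ge0 ?(ltW (m_gt0 _ _))//.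
by apply: sumr_le0 => y _; rewrite mulr_ge0_le0 ?mu_ge0// subr_le0.
Qed.

Lemma half_invm_ge0 x : 0 <= 2^-1 * (m x)^-1.
Proof. by rewrite mulr_ge0 ?invr_ge0 ?ltW ?m_gt0. Qed.

Lemma half_degree_ge0 x : 0 <= half_degree x.
Proof. by rewrite mulr_ge0 ?half_invm_ge0// sumr_ge0// => y _; exact: mu_ge0. Qed.

Lemma Gam_ge0 f x : 0 <= Gam f f x.
Proof.
rewrite GamE mulr_ge0 ?half_invm_ge0//.
by rewrite sumr_ge0// => y _; rewrite mulr_ge0 ?mu_ge0// -expr2 sqr_ge0.
Qed.

(** Edge by edge, [2 b^2 + 2 (a - b)^2 - a^2] is the square [(a - 2 b)^2]. *)
Lemma Gam_split f g x : Gam f f x <= 2 * Gam g g x + 2 * Gam (f \- g) (f \- g) x.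
Proof.
rewrite !GamE.
set A := \sum_(y <- _) _; set B := \sum_(y <- _) _; set C := \sum_(y <- _) _.
suff : A <= 2 * B + 2 * C by move=> /(ler_wpM2l (half_invm_ge0 x)); lra.
rewrite !mulr_sumr -big_split/= ler_sum// => y _.
have := mulr_ge0 (mu_ge0 x y) (sqr_ge0 (f y - f x - 2 * (g y - g x))).
by rewrite expr2; lra.
Qed.

(** On each edge with increment [d], AM-GM gives [|d| <= (e + d^2 / e) / 2]. The parameter [e] stays
    free, to be balanced later against the size of [Gam]. *)
Lemma Lap_le_Gam f x (e : R) : 0 < e ->
  `|Lap f x| <= e * half_degree x + e^-1 * Gam f f x.
Proof.
move=> e0; rewrite LapE GamE /half_degree normrM ger0_norm; last first.
  by rewrite invr_ge0 ltW ?m_gt0.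
set A := \sum_(y <- _) _; set B := \sum_(y <- _) _; set C := \sum_(y <- _) _.
suff : `|A| <= 2^-1 * (e * B + e^-1 * C).
  have: 0 <= (m x)^-1 by rewrite invr_ge0 ltW ?m_gt0.
  by move=> /ler_wpM2l /[apply]; lra.
rewrite (le_trans (ler_norm_sum _ _ _))// !mulr_sumr -big_split/= mulr_sumr.
rewrite ler_sum// => y _; rewrite normrM ger0_norm ?mu_ge0//.
set d := f y - f x; have -> : d * d = `|d| * `|d| by rewrite -!expr2 real_normK ?num_real.
rewrite [leRHS](_ : _ = mu x y * (2^-1 * (e + e^-1 * (`|d| * `|d|)))); last by ring.
rewrite ler_wpM2l ?mu_ge0//.
have : 0 <= e^-1 * (e - `|d|) ^+ 2 by rewrite mulr_ge0 ?sqr_ge0// invr_ge0 ltW.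
rewrite (_ : e^-1 * (e - `|d|) ^+ 2 = e + e^-1 * (`|d| * `|d|) - 2 * `|d|); last first.
  by field; rewrite gt_eqF.
by move: (e^-1 * _) => z; lra.
Qed.

(** Summing over the second vertex first, the inner sum is [2 * Gam f f x * m G x]. The energy
    becomes a sum of nonnegative terms over vertices, to which the tail and single-term bounds
    apply. *)
Lemma energyE f :
  energy G f = (\esum_(x in [set: V]) (Gam f f x * m x)%:E)%E.
Proof.
rewrite /energy (_ : [set: V * V] = [set: V] `*`` (fun=> [set: V])); last first.
  by apply/seteqP; split.
rewrite -(esum_esum (a := fun x y => (mu x y * (f y - f x) ^+ 2)%:E)); last first.
  by move=> x y _ _; rewrite lee_fin mulr_ge0 ?mu_ge0 ?sqr_ge0.
rewrite (eq_esum (b := fun x => (2 * (Gam f f x * m x))%:E)); last first.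
  move=> x _.
  rewrite -(@sumE_ge0E _ _ (fun y => mu x y * (f y - f x) ^+ 2)); last first.
    by move=> y; rewrite mulr_ge0 ?mu_ge0 ?sqr_ge0.
  rewrite (@sumE_finite _ _ _ (nbs x)) ?nbs_uniq//; last first.
    by move=> y; rewrite mem_nbs => /mu_eq0 ->; rewrite mul0r.
  congr EFin; rewrite GamE; under eq_bigr do rewrite expr2.
  by field; rewrite gt_eqF ?m_gt0.
under eq_esum do rewrite mulr_natl mulr2n EFinD.
rewrite esumD; last 2 first.
- by move=> x _; rewrite lee_fin mulr_ge0 ?Gam_ge0// ltW ?m_gt0.
- by move=> x _; rewrite lee_fin mulr_ge0 ?Gam_ge0// ltW ?m_gt0.
by rewrite -mule2n -mule_natl muleA -EFinM mulVf// mul1e.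
Qed.

Lemma Lap_indic y x :
  Lap \1_[set y] x * m x = mu x y - (x == y)%:R * \sum_(z <- nbs x) mu x z.
Proof.
rewrite LapE mulrAC mulVf ?gt_eqF ?m_gt0// mul1r.
under eq_bigr do rewrite !indic1E mulrBr.
rewrite sumrB -mulr_suml [X in _ - X]mulrC; congr (_ - _).
have [xy|xy] := boolP (edge G x y).
  rewrite (bigD1_seq y) ?mem_nbs ?nbs_uniq//= eqxx mulr1 big1 ?addr0// => z /negPf ->.
  by rewrite mulr0.
rewrite mu_eq0// big_seq big1// => z; rewrite mem_nbs => xz.
by case: eqP => [zy|_]; [rewrite -zy xz in xy|rewrite mulr0].
Qed.

Lemma inner_indic f y : inner G f \1_[set y] = f y * m y.
Proof.
rewrite /inner (@sumE_finite _ _ _ [:: y])//.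
  by rewrite big_seq1/= indic1E eqxx mulr1.
by move=> x; rewrite inE indic1E => /negPf ->; rewrite mulr0 mul0r.
Qed.

Lemma sum_nbs_diag y f : \sum_(z <- nbs y) mu y z * f z =
  mu y y * f y + \sum_(z <- nbs y | z != y) mu y z * f z.
Proof.
have [yy|yy] := boolP (edge G y y).
  by rewrite (bigD1_seq y) ?mem_nbs ?nbs_uniq.
rewrite mu_eq0// mul0r add0r [RHS]big_mkcond; apply: eq_big_seq => z.
by rewrite mem_nbs; case: eqP => //= -> yy'; rewrite yy' in yy.
Qed.

(** Only [y] and its neighbours contribute, so the sum is finite for arbitrary [g]. Splitting off
    the diagonal lets a possible self-loop at [y] cancel. *)
Lemma inner_Lap_indic g y : inner G g (Lap \1_[set y]) = Lap g y * m y.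
Proof.
rewrite /inner (@sumE_finite _ _ _ (y :: [seq z <- nbs y | z != y])) /=.
- rewrite big_cons big_filter -mulrA Lap_indic eqxx mul1r.
  rewrite [X in _ + X = _](eq_bigr (fun z => g z * mu y z)); last first.
    by move=> z /negPf zy; rewrite -mulrA Lap_indic zy mul0r subr0 mu_sym.
  rewrite LapE mulrAC mulVf ?gt_eqF ?m_gt0// mul1r.
  have -> : \sum_(z <- nbs y) mu y z = mu y y + \sum_(z <- nbs y | z != y) mu y z.
    transitivity (\sum_(z <- nbs y) mu y z * 1).
      by apply: eq_bigr => z _; rewrite mulr1.
    rewrite (sum_nbs_diag y (fun=> 1)) mulr1; congr (_ + _).
    by apply: eq_bigr => z _; rewrite mulr1.
  rewrite sum_nbs_diag subrr mulr0 add0r.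
  under [RHS]eq_bigr do rewrite mulrBr (mulrC _ (g _)).
  rewrite sumrB -mulr_suml; ring.
- by rewrite mem_filter eqxx/= filter_uniq// nbs_uniq.
- move=> x; rewrite inE negb_or mem_filter negb_and => /andP[xy].
  rewrite xy/= mem_nbs => yx.
  by rewrite -mulrA Lap_indic (negPf xy) mul0r subr0 mu_eq0 ?mulr0// edge_sym.
Qed.

(** The nonzero terms sit at [(y, z)] and [(z, y)] with [z] a neighbour other than [y]. By symmetry
    the two families have equal sums, which absorbs the factor 1/2. *)
Lemma formQ_indic g y : formQ G g \1_[set y] = - (Lap g y * m y).
Proof.
rewrite /formQ; set nby := [seq z <- nbs y | z != y].
have nby_uniq : uniq nby by rewrite filter_uniq ?nbs_uniq.
rewrite (@sumE_finite _ _ _ ([seq (y, z) | z <- nby] ++ [seq (z, y) | z <- nby])) /=.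
- rewrite big_cat/= !big_map/= !big_filter.
  rewrite [X in X + _](eq_bigr (fun z => - (mu y z * (g z - g y)))); last first.
    by move=> z /negPf zy; rewrite !indic1E zy eqxx sub0r mulrN1.
  rewrite [X in _ + X](eq_bigr (fun z => - (mu y z * (g z - g y)))); last first.
    by move=> z /negPf zy; rewrite !indic1E zy eqxx subr0 mulr1 mu_sym -mulrN opprB.
  rewrite sumrN LapE [X in _ = - X]mulrAC mulVf ?gt_eqF ?m_gt0// mul1r.
  rewrite sum_nbs_diag subrr mulr0 add0r; lra.
- rewrite cat_uniq !map_inj_uniq ?nby_uniq//=; first last.
  + by move=> ? ? [].
  + by move=> ? ? [].
  rewrite andbT; apply/hasPn => _ /mapP[z zy ->]; apply/mapP => -[w wy [zyE _]].
  by move: zy; rewrite zyE mem_filter eqxx.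
- move=> [x z]; rewrite mem_cat negb_or => /andP[/mapP xz /mapP zx] /=.
  rewrite !indic1E; have [zy|zy] := eqVneq z y; have [xy|xy] := eqVneq x y.
  + by rewrite subrr mulr0.
  + rewrite mu_eq0 ?mul0r//; apply/negP => xz'; apply: zx; exists x; last by rewrite zy.
    by rewrite mem_filter xy mem_nbs -zy edge_sym.
  + rewrite mu_eq0 ?mul0r//; apply/negP => xz'; apply: xz; exists z; last by rewrite xy.
    by rewrite mem_filter zy mem_nbs -xy.
  + by rewrite subrr mulr0.
Qed.

End graph_calculus.

(** * Bounds on the squared norm, and finitely supported functions *)

Section sqnorm_bounds.
Variables (R : realType) (V : choiceType) (G : weighted_graph R V).
Implicit Types (f g h : V -> R) (a b c : R).

Lemma m_ge0 x : 0 <= m G x.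
Proof. exact/ltW/m_gt0. Qed.

Lemma sqrm_ge0 f x : 0 <= f x ^+ 2 * m G x.
Proof. by rewrite mulr_ge0 ?sqr_ge0 ?m_ge0. Qed.

Lemma sqnorm_ge0 f : (0 <= sqnorm G f)%E.
Proof. by apply: (@esum_ge0 R) => x _; rewrite lee_fin sqrm_ge0. Qed.

Lemma ell2P f : ell2 G f <-> exists c, (sqnorm G f <= c%:E)%E.
Proof.
split=> [ff|[c fc]]; last by rewrite /ell2/= (le_lt_trans fc) ?ltry.
by exists (fine (sqnorm G f)); rewrite fineK// ge0_fin_numE ?sqnorm_ge0.
Qed.

(** The pointwise inequality is summed over finite sets. Carrying real bounds [a], [b] instead of
    the norms keeps all later arithmetic in [R]. *)
Lemma sqnorm_comb f g h (A B : R) a b : 0 <= A -> 0 <= B ->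
  (forall x, h x ^+ 2 <= A * f x ^+ 2 + B * g x ^+ 2) ->
  (sqnorm G f <= a%:E)%E -> (sqnorm G g <= b%:E)%E ->
  (sqnorm G h <= (A * a + B * b)%:E)%E.
Proof.
move=> A0 B0 hfg fa gb; apply: esum_le_fin => r ur.
have fr := sum_le_esum (sqrm_ge0 f) fa ur.
have gr := sum_le_esum (sqrm_ge0 g) gb ur.
rewrite (le_trans _ (lerD (ler_wpM2l A0 fr) (ler_wpM2l B0 gr)))//.
rewrite !mulr_sumr -big_split/= ler_sum// => x _.
by rewrite (mulrA A) (mulrA B) -mulrDl ler_wpM2r ?m_ge0 ?hfg.
Qed.

Lemma sqnormD f g a b :
  (sqnorm G f <= a%:E)%E -> (sqnorm G g <= b%:E)%E ->
  (sqnorm G (f \+ g)%R <= (2 * a + 2 * b)%:E)%E.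
Proof.
apply: sqnorm_comb => // x /=.
by have := sqr_ge0 (f x - g x); rewrite !expr2; lra.
Qed.

Lemma sqnormN f : sqnorm G (fun x => - f x) = sqnorm G f.
Proof. by apply: eq_esum => x _; rewrite sqrrN. Qed.

Lemma sqnormB f g a b :
  (sqnorm G f <= a%:E)%E -> (sqnorm G g <= b%:E)%E ->
  (sqnorm G (f \- g)%R <= (2 * a + 2 * b)%:E)%E.
Proof. by move=> fa gb; apply: sqnormD => //; rewrite sqnormN. Qed.

Lemma sqnormZ (k : R) f a : (sqnorm G f <= a%:E)%E ->
  (sqnorm G (fun x => (k * f x)%R) <= (k ^+ 2 * a)%:E)%E.
Proof.
move=> fa; rewrite -[_ * a]addr0 -(mul0r a).
by apply: (sqnorm_comb _ _ _ fa fa); rewrite ?sqr_ge0// => x; rewrite mul0r addr0 exprMn.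
Qed.

Lemma sqnorm_finite f (r : seq V) : (forall x, x \notin r -> f x = 0) ->
  sqnorm G f = (\sum_(x <- undup r) f x ^+ 2 * m G x)%:E.
Proof.
move=> fr; rewrite /sqnorm -(sumE_ge0E (sqrm_ge0 f)).
by apply: sumE_finite; rewrite ?undup_uniq// => x; rewrite mem_undup => /fr ->; rewrite expr0n/= mul0r.
Qed.

Lemma finsuppP f : finitely_supported f ->
  exists r : seq V, forall x, x \notin r -> f x = 0.
Proof.
move=> fs; exists (enum_fset (fset_set [set x | f x != 0])) => x.
rewrite -[_ \in _]/(x \in fset_set _) in_fset_set// => /negP.
by rewrite in_setE/= => /negP; rewrite negbK => /eqP.
Qed.

Lemma ell2_finsupp f : finitely_supported f -> ell2 G f.
Proof. by move=> /finsuppP[r fr]; rewrite /ell2/= (sqnorm_finite fr) ltry. Qed.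

Lemma finsupp_indic (y : V) : finitely_supported (\1_[set y] : V -> R).
Proof.
apply: (sub_finite_set (B := [set y])); last exact: finite_set1.
by move=> x /=; rewrite indic1E; have [//|] := eqVneq x y; rewrite eqxx.
Qed.

Lemma finsupp_Lap_indic (y : V) : finitely_supported (Lap G \1_[set y]).
Proof.
apply: (sub_finite_set (B := [set` y :: nbs G y])); last exact: finite_seq.
move=> x /=; apply: contraNT; rewrite inE negb_or mem_nbs => /andP[xy yx].
rewrite -(mulfK (lt0r_neq0 (m_gt0 G x)) (Lap _ _ _)) Lap_indic.
by rewrite (negPf xy) mul0r subr0 mu_eq0 ?mul0r// edge_sym.
Qed.

Lemma energy_finsupp f : finitely_supported f -> (energy G f < +oo)%E.
Proof.
move=> /finsuppP[r fr]; rewrite energyE.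
have Gm x : 0 <= Gam G f f x * m G x by rewrite mulr_ge0 ?Gam_ge0 ?m_ge0.
rewrite -(sumE_ge0E Gm) (@sumE_finite _ _ _ (undup (r ++ flatten (map (nbs G) r)))).
- by rewrite ltry.
- exact: undup_uniq.
move=> x; rewrite mem_undup mem_cat negb_or => /andP[xr /flatten_mapP xnb].
rewrite GamE big_seq big1 ?mulr0 ?mul0r// => y; rewrite mem_nbs => xy.
rewrite (fr x)// (fr y) ?subrr ?mul0r ?mulr0//.
by apply/negP => yr; apply: xnb; exists y => //; rewrite mem_nbs edge_sym.
Qed.

Lemma domQ_finsupp f : finitely_supported f -> domQ G f.
Proof.
move=> fs; split; first exact: ell2_finsupp.
exists (fun=> f); split => //.
rewrite (_ : sqnormQ G (f \- f)%R = 0%E); first exact: cvg_cst.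
rewrite /sqnormQ energyE /sqnorm !esum1 ?adde0// => x _ /=.
  by rewrite GamE big1 ?mulr0 ?mul0r// => y _ /=; rewrite !subrr mul0r mulr0.
by rewrite subrr expr0n/= mul0r.
Qed.

Lemma cvge0_lt (T : Type) (F : set_system T) (u : T -> \bar R) (e : R) :
  u @ F --> 0%E -> 0 < e -> \forall x \near F, (u x < e%:E)%E.
Proof.
by move=> u0 e0; apply: (u0 [set y | (y < e%:E)%E]); apply: open_ereal_lt'; rewrite lte_fin.
Qed.

Lemma cvge0 (T : Type) (F : set_system T) (FF : Filter F) (u : T -> \bar R) :
  (forall x, 0 <= u x)%E ->
  (forall e, 0 < e -> \forall x \near F, (u x <= e%:E)%E) ->
  u @ F --> 0%E.
Proof.
move=> u0 ue; apply/fine_cvgP; split.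
  apply: filterS (ue 1 ltr01) => x ux.
  by rewrite ge0_fin_numE// (le_lt_trans ux) ?ltry.
apply/cvgr0Pnorm_le => e /ue; apply: filterS => x /=.
by move: (u0 x); case: (u x) => //= r; rewrite !lee_fin => r0; rewrite ger0_norm.
Qed.

End sqnorm_bounds.

(** * The generator of the Dirichlet form *)

Section generator.
Variables (R : realType) (V : choiceType) (G : weighted_graph R V).
Variables (L : operator R V) (hL : dirichlet_generator G L).
Implicit Types (f g : V -> R).

(** With [S] the square root of [-L], pair with the indicator of [x]: self-adjointness of [S] turns
    the pairing of [S (S f)] into the form, which Green's formula evaluates as
    [- Lap G f x * m G x]. *)
Lemma generatorE f : dom L f -> act L f = Lap G f.
Proof.
case: hL => _ _ [S [[[[_ Sell2 _ _] _ Sadj] _ domLS SS] domSQ SQ]] Lf.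
apply/funext => x.
have [Sf SSf] := (domLS f).1 Lf.
have domS1 : dom S \1_[set x] by rewrite domSQ; exact/domQ_finsupp/finsupp_indic.
have /Sadj : ell2 G \1_[set x] by exact/ell2_finsupp/finsupp_indic.
move=> /(_ (act S \1_[set x]) (Sell2 _ domS1)) [_ /(_ (conj domS1 erefl))].
move=> /(_ (act S f) SSf); rewrite SS//= inner_indic.
rewrite -SQ -?domSQ// formQ_indic mulNr => /oppr_inj.
by apply: mulIf; rewrite gt_eqF ?m_gt0.
Qed.

(** By Green's formula the indicator lies in the domain of the adjoint of [L], which is [dom L]. *)
Lemma generator_dom_indic y : dom L \1_[set y].
Proof.
case: (hL) => -[_ _ Ladj] _ _.
have /Ladj : ell2 G \1_[set y] by exact/ell2_finsupp/finsupp_indic.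
move=> /(_ (Lap G \1_[set y])) [|+ _].
  exact/ell2_finsupp/finsupp_Lap_indic.
by case=> // g /generatorE ->; rewrite inner_indic inner_Lap_indic.
Qed.

(** Some finitely supported [u n] is at finite energy distance from [f], and [Gam_split] adds the
    two energies. Finiteness matters because [formQ] is defined through [fine], which sends [+oo] to
    0. *)
Lemma domQ_energy f : domQ G f -> (energy G f < +oo)%E.
Proof.
case=> _ [u [u0 /cvge0_lt /(_ ltr01)]] [n _ /(_ n (leqnn n)) /= unf].
have eun := energy_finsupp G (u0 n).
have euf : (energy G (u n \- f)%R < +oo)%E.
  apply: le_lt_trans (lt_trans unf (ltry 1)).
  by rewrite /sqnormQ leeDr// sqnorm_ge0.
apply: le_lt_trans (lte_add_pinfty (lte_add_pinfty eun eun) (lte_add_pinfty euf euf)).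
have Gm h x : (0 <= (Gam G h h x * m G x)%:E)%E.
  by rewrite lee_fin mulr_ge0 ?Gam_ge0 ?m_ge0.
rewrite !energyE -!esumD//; first last.
- by move=> x _; rewrite adde_ge0.
- by move=> x _; rewrite adde_ge0.
apply: le_esum => x _; rewrite -!EFinD lee_fin.
have /(ler_wpM2r (m_ge0 G x)) := Gam_split G f (u n) x.
rewrite (_ : Gam G (f \- u n)%R _ x = Gam G (u n \- f)%R (u n \- f)%R x); last first.
  by rewrite !GamE; congr (_ * _); apply: eq_bigr => y _ /=; ring.
by lra.
Qed.

(** The energy of [f] is the pairing of [-L f] with [f], and [- p q <= (p^2 + q^2) / 2] pointwise.
    Graph norm bounds thus control the total mass of [Gam f f]. *)
Lemma generator_energy f a b : dom L f ->
  (sqnorm G f <= a%:E)%E -> (sqnorm G (Lap G f) <= b%:E)%E ->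
  (\esum_(x in [set: V]) (Gam G f f x * m G x)%:E <= (2^-1 * (a + b))%:E)%E.
Proof.
move=> Lf fa fb.
case: (hL) => _ _ [S [[[[_ Sell2 _ _] _ Sadj] _ domLS SS] domSQ SQ]].
have [Sf SSf] := (domLS f).1 Lf.
have Qf : domQ G f by rewrite -domSQ.
have : formQ G f f <= 2^-1 * (a + b).
  rewrite SQ//.
  have /Sadj : ell2 G f by apply/ell2P; exists a.
  move=> /(_ (act S f) (Sell2 _ Sf)) [_ /(_ (conj Sf erefl)) /(_ _ SSf) <-].
  rewrite SS//= (generatorE Lf).
  apply: (fine_sumE_le (b := fun x => 2^-1 * (f x ^+ 2 * m G x + Lap G f x ^+ 2 * m G x))).
  - move=> x; rewrite -mulrDl mulrA ler_wpM2r ?m_ge0//.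
    by have := sqr_ge0 (f x + Lap G f x); rewrite !expr2; lra.
  - by move=> x; rewrite mulr_ge0// addr_ge0 ?sqrm_ge0.
  apply: esum_le_fin => r ur; rewrite -mulr_sumr ler_wpM2l// big_split/=.
  by rewrite lerD ?(sum_le_esum (sqrm_ge0 G _)).
have := domQ_energy Qf.
rewrite -energyE /energy /formQ sumE_ge0E; last first.
  by move=> p; rewrite -mulrA mulr_ge0 ?mu_ge0// -expr2 sqr_ge0.
under [X in fine X]eq_esum do rewrite -mulrA -expr2.
set E := esum _ _.
have : (0 <= E)%E by apply: esum_ge0 => p _; rewrite lee_fin mulr_ge0 ?mu_ge0 ?sqr_ge0.
(* The value [+oo] is excluded by the finite energy of [f]. *)
case: E => [r _ _| _ |//]; first by rewrite -EFinM lee_fin.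
by rewrite gt0_muley ?lte_fin ?invr_gt0// ltxx.
Qed.

End generator.

(** * Completeness of the weighted sequence space *)

Section ell2_complete.
Variables (R : realType) (V : choiceType) (G : weighted_graph R V).

(** Each term of the norm is dominated by the norm, so [x k v] is Cauchy at every vertex [v]. The
    bound by [rho n] passes to the pointwise limit on each finite partial sum. *)
Lemma ell2_complete (x : nat -> V -> R) (rho : nat -> R) :
  (forall e, 0 < e -> exists n, rho n < e) ->
  (forall n k, (n <= k)%N -> (sqnorm G (x k \- x n)%R <= (rho n)%:E)%E) ->
  exists y, forall n, (sqnorm G (y \- x n)%R <= (rho n)%:E)%E.
Proof.
move=> rho0 xrho.
have xcvg v : cvg (x k v @[k --> \oo]).
  apply/cauchy_cvgP/cauchy_exP => e e0.
  have [|n rhon] := rho0 (e ^+ 2 * m G v); first by rewrite mulr_gt0 ?exprn_gt0 ?m_gt0.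
  exists (x n v); exists n => // k /= nk; rewrite /ball/= distrC.
  have := le_term_esum v (sqrm_ge0 G _) (xrho _ _ nk).
  move=> /le_lt_trans /(_ rhon); rewrite ltr_pM2r ?m_gt0// -ltr_sqrt ?exprn_gt0//.
  by rewrite !sqrtr_sqr [in ltRHS]gtr0_norm.
exists (fun v => lim (x k v @[k --> \oo])) => n.
apply: esum_le_fin => r ur.
apply: (cvgr_to_le (F := \oo) (f := fun k => \sum_(v <- r) (x k v - x n v) ^+ 2 * m G v)).
  apply: cvg_big => [|v _]; first exact: add_continuous.
  apply: cvgM; last exact: cvg_cst.
  by rewrite expr2; under eq_fun do rewrite expr2; apply: cvgM; apply: cvgB => //; exact: cvg_cst.
by exists n => // k /= /xrho xk; exact: (sum_le_esum (sqrm_ge0 G _) xk ur).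
Qed.

End ell2_complete.

(** * Linearity of the semigroup and the nested balls step *)

Section uniform_boundedness.
Variables (R : realType) (V : choiceType) (G : weighted_graph R V).
Variable P : R -> (V -> R) -> V -> R.
Hypothesis Plinear : forall t, 0 <= t -> linear_operator G (Operator (ell2 G) (P t)).
Hypothesis Pbounded : forall t, 0 <= t ->
  exists C : R, forall f, ell2 G f -> (sqnorm G (P t f) <= C%:E * sqnorm G f)%E.
Implicit Types (f g : V -> R).

Lemma ell2_lin (k : R) f g : ell2 G f -> ell2 G g -> ell2 G (fun x => k * f x + g x).
Proof. by move=> ff gg; case: (Plinear (lexx 0)) => _ _ _ /(_ k f g ff gg)[]. Qed.

Lemma semigroup_lin t (k : R) f g : 0 <= t -> ell2 G f -> ell2 G g ->
  P t (fun x => k * f x + g x) = (fun x => k * P t f x + P t g x).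
Proof. by move=> /Plinear[_ _ _ H] ff gg; case: (H k f g ff gg). Qed.

Lemma semigroup_ell2 t f : 0 <= t -> ell2 G f -> ell2 G (P t f).
Proof. by move=> /Plinear[_ H _ _] /H. Qed.

Lemma ell2D f g : ell2 G f -> ell2 G g -> ell2 G (f \+ g).
Proof.
move=> ff gg; have := ell2_lin 1 ff gg.
by rewrite (_ : (fun x => _) = f \+ g)//; apply/funext => x; rewrite mul1r.
Qed.

Lemma ell2B f g : ell2 G f -> ell2 G g -> ell2 G (f \- g).
Proof.
move=> ff gg; have := ell2_lin (-1) gg ff.
by rewrite (_ : (fun x => _) = f \- g)//; apply/funext => x; rewrite mulN1r addrC.
Qed.

Lemma semigroupB t f g : 0 <= t -> ell2 G f -> ell2 G g ->
  P t (f \- g) = P t f \- P t g.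
Proof.
move=> t0 ff gg; have := semigroup_lin (-1) t0 gg ff.
rewrite (_ : (fun x => _) = f \- g); last by apply/funext => x; rewrite mulN1r addrC.
by move=> ->; apply/funext => x; rewrite mulN1r addrC.
Qed.

Lemma semigroupZ t (k : R) f : 0 <= t -> ell2 G f ->
  P t (fun x => k * f x) = (fun x => k * P t f x).
Proof.
move=> t0 ff; have := semigroup_lin (k - 1) t0 ff ff.
rewrite (_ : (fun x => _) = (fun x => k * f x)); last by apply/funext => x; ring.
by move=> ->; apply/funext => x; ring.
Qed.

Lemma semigroup_bound t : 0 <= t -> exists2 C : R, 0 < C &
  forall f c, (sqnorm G f <= c%:E)%E -> (sqnorm G (P t f) <= (C * c)%:E)%E.
Proof.
move=> t0; have [C PC] := Pbounded t0; exists (`|C| + 1); first by rewrite ltr_pwDr.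
move=> f c fc; have ff : ell2 G f by apply/ell2P; exists c.
apply: (le_trans (PC _ ff)).
have c0 : 0 <= c by rewrite -lee_fin (le_trans _ fc) ?sqnorm_ge0.
apply: (@le_trans _ _ ((`|C| + 1)%:E * sqnorm G f)%E).
  by rewrite lee_wpmul2r ?sqnorm_ge0// lee_fin (le_trans (ler_norm C))// lerDl.
by rewrite EFinM lee_wpmul2l// lee_fin addr_ge0.
Qed.

(* A vector on which P t is large lets one shrink the ball around x to a ball on
   all of which P t is at least B: either x or x + g serves as the new centre. *)
Lemma gliding_step (f x : V -> R) (t r B : R) : 0 <= t -> 0 < r -> 0 < B ->
  ell2 G x ->
  (sqnorm G f <= 1)%E -> ~ (sqnorm G (P t f) <= (16 * (2 * B + 2) / r)%:E)%E ->
  exists x' r', [/\ 0 < r', r' <= r / 4, ell2 G x',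
    forall y, (sqnorm G (y \- x')%R <= r'%:E)%E -> (sqnorm G (y \- x)%R <= r%:E)%E &
    forall y, (sqnorm G (y \- x')%R <= r'%:E)%E -> ~ (sqnorm G (P t y) <= B%:E)%E].
Proof.
move=> t0 r0 B0 xx f1 Pf.
have ff : ell2 G f by apply/ell2P; exists 1.
(* The scaling gives [sqnorm g <= r / 4]. If both [P t x] and [P t (x + g)] were bounded by
   [2 B + 2], then [P t g] would be bounded by [4 (2 B + 2)], and dividing by [k^2 = r / 4] would
   bound [P t f] by the excluded constant. *)
pose k := Num.sqrt r / 2; pose g := fun v => k * f v.
have k2 : k ^+ 2 = r / 4 by rewrite expr_div_n sqr_sqrtr ?ltW// -natrX.
have k0 : 0 < k by rewrite divr_gt0 ?sqrtr_gt0.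
have gr : (sqnorm G g <= (r / 4)%:E)%E by rewrite -k2 -[k ^+ 2]mulr1; exact: sqnormZ.
have gg : ell2 G g by apply/ell2P; exists (r / 4).
have [x' [xx' xr PB]] : exists x', [/\ ell2 G x', (sqnorm G (x' \- x)%R <= (r / 4)%:E)%E
    & ~ (sqnorm G (P t x') <= (2 * B + 2)%:E)%E].
  have [Px|Px] := pselect (sqnorm G (P t x) <= (2 * B + 2)%:E)%E; last first.
    exists x; split => //; rewrite (_ : (x \- x)%R = (fun v => 0 * g v)); last first.
      by apply/funext => v /=; rewrite subrr mul0r.
    rewrite (le_trans (sqnormZ 0 gr))// expr0n/= mul0r lee_fin divr_ge0 ?ltW//.
  exists (g \+ x); split; first exact: ell2D.
    by rewrite (_ : (_ \- _)%R = g)//; apply/funext => v /=; rewrite addrK.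
  move=> Pgx; apply: Pf; have := sqnormZ k^-1 (sqnormB Pgx Px).
  rewrite -semigroupB//; last exact: ell2D.
  rewrite (_ : ((g \+ x) \- x)%R = g); last by apply/funext => v /=; rewrite addrK.
  rewrite semigroupZ// (_ : (fun _ => _) = P t f); last first.
    by apply/funext => v /=; rewrite mulKf ?gt_eqF.
  move=> /le_trans; apply; rewrite lee_fin exprVn k2 invf_div.
  rewrite le_eqVlt; apply/orP; left; apply/eqP.
  by field; rewrite gt_eqF.
(* On the ball of squared radius [C^-1] around [x'], [P t (y - x')] has squared norm at most 1.
   Hence [P t y <= B] there would give [P t x' <= 2 B + 2]. *)
have [C C0 PC] := semigroup_bound t0.
exists x', (Num.min (r / 4) C^-1); split => //.
- by rewrite lt_min divr_gt0 ?invr_gt0//.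
- by rewrite ge_min lexx.
- move=> y yx; rewrite (_ : (y \- x)%R = ((y \- x') \+ (x' \- x))%R); last first.
    by apply/funext => v /=; rewrite addrA subrK.
  have /sqnormD /(_ xr) : (sqnorm G (y \- x')%R <= (r / 4)%:E)%E.
    by rewrite (le_trans yx)// lee_fin ge_min lexx.
  by move=> /le_trans; apply; rewrite lee_fin; lra.
- move=> y yx Py; apply: PB.
  have {}yx : (sqnorm G (y \- x')%R <= C^-1%:E)%E.
    by rewrite (le_trans yx)// lee_fin ge_min lexx orbT.
  have yy : ell2 G y.
    rewrite (_ : y = (y \- x') \+ x'); last by apply/funext => v /=; rewrite subrK.
    by apply: ell2D => //; apply/ell2P; exists C^-1.
  have := sqnormB Py (PC _ _ yx); rewrite divff ?gt_eqF// mulr1.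
  rewrite semigroupB// (_ : (P t y \- _)%R = P t x')//.
  by apply/funext => v /=; rewrite opprB addrC subrK.
Qed.

End uniform_boundedness.

(** * Local uniform boundedness in time *)

Section uniform_boundedness_interval.
Variables (R : realType) (V : choiceType) (G : weighted_graph R V).
Variables (L : operator R V) (P : R -> (V -> R) -> V -> R).
Hypothesis hP : exp_semigroup G L P.
Implicit Types (f g : V -> R).

Let Plinear t (t0 : 0 <= t) : linear_operator G (Operator (ell2 G) (P t)).
Proof. by case: hP => /(_ t t0)[]. Qed.

Let Pbounded t (t0 : 0 <= t) :
  exists C : R, forall f, ell2 G f -> (sqnorm G (P t f) <= C%:E * sqnorm G f)%E.
Proof. by case: hP => /(_ t t0)[]. Qed.

Lemma semigroup_cvg0 f e : ell2 G f -> 0 < e ->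
  exists2 d, 0 < d & forall t, 0 < t -> t < d -> (sqnorm G (P t f \- f)%R < e%:E)%E.
Proof.
move=> ff e0; case: hP => _ _ _ /(_ f ff) Pf _.
have [d /= d0 dP] := cvge0_lt Pf e0; exists d => // t t0 td.
by apply: dP => //=; rewrite sub0r normrN gtr0_norm.
Qed.

(** Otherwise [gliding_step] yields nested balls and times tending to 0 such that the operators at
    these times grow without bound on the balls. At the common point of the balls this contradicts
    strong continuity at 0. *)
Lemma semigroup_bounded_near0 : exists delta M, [/\ 0 < delta, 0 < M &
  forall t f, 0 < t -> t <= delta -> (sqnorm G f <= 1)%E ->
    (sqnorm G (P t f) <= M%:E)%E].
Proof.
apply: contrapT => nb.
have unb delta M : 0 < delta -> 0 < M -> exists t f, [/\ 0 < t, t <= delta,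
    (sqnorm G f <= 1)%E & ~ (sqnorm G (P t f) <= M%:E)%E].
  move=> d0 M0; apply: contrapT => h; apply: nb; exists delta, M; split => // t f t0 td f1.
  by apply: contrapT => Pf; apply: h; exists t, f.
(* A state is a centre, a squared radius, and the time chosen at that step; the time of the initial
   state is a dummy. *)
pose T := ((V -> R) * R * R)%type.
pose valid (q : T) := 0 < q.1.2 /\ ell2 G q.1.1.
pose inball (q : T) y := (sqnorm G (y \- q.1.1)%R <= q.1.2%:E)%E.
have step (p : nat * T) : exists q : T, valid p.2 -> [/\ valid q,
    q.1.2 <= p.2.1.2 / 4, 0 < q.2 <= p.1.+1%:R^-1,
    forall y, inball q y -> inball p.2 y &
    forall y, inball q y -> ~ (sqnorm G (P q.2 y) <= p.1.+1%:R%:E)%E].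
  have [[r0 xx]|nv] := pselect (valid p.2); last by exists p.2.
  have [] := unb p.1.+1%:R^-1 (16 * (2 * p.1.+1%:R + 2) / p.2.1.2).
  - by rewrite invr_gt0.
  - by rewrite divr_gt0// mulr_gt0// addr_gt0// mulr_gt0.
  move=> t [f [t0 tn f1 Pf]].
  have [//|x' [r' [r'0 r'r xx' nest low]]] :=
    gliding_step Plinear Pbounded (ltW t0) r0 _ xx f1 Pf.
  by exists (x', r', t) => _; split => //=; rewrite t0.
have [F FP] := choice step.
pose s := nat_rect (fun=> T) ((cst 0, 1, 0) : T) (fun n q => F (n, q)).
have vs n : valid (s n).
  elim: n => [|n IH]; first by split => //=; case: (Plinear (lexx 0)).
  by have [] := FP (n, s n) IH.
have rs n : (s n).1.2 <= n.+1%:R^-1.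
  elim: n => [|n IH]; first by rewrite /= invr1.
  have [_ /= + _ _ _] := FP (n, s n) (vs n); move=> /le_trans; apply.
  rewrite ler_pdivrMr// (le_trans IH)//.
  rewrite ler_pdivlMl// ler_pdivrMr// -natrM ler_nat mulnS.
  by apply: (@leq_add 2 n 4); rewrite ?leq_pmull.
have nest k n y : inball (s (n + k)%N) y -> inball (s n) y.
  elim: k => [|k IH]; first by rewrite addn0.
  rewrite addnS => h; apply: IH.
  by have [_ _ _ /(_ y) + _] := FP ((n + k)%N, s (n + k)%N) (vs _); exact.
have [e e0|n k nk|y yP] := @ell2_complete _ _ G (fun n => (s n).1.1) (fun n => (s n).1.2).
- have [n _ /(_ n (leqnn n)) ne] := near_infty_natSinv_lt (PosNum e0).
  by exists n; rewrite (le_lt_trans (rs n)).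
- apply: (nest (k - n)%N n); rewrite subnKC// /inball.
  rewrite (_ : (_ \- _)%R = cst 0); last by apply/funext => v /=; rewrite subrr.
  rewrite /sqnorm esum1 ?lee_fin ?ltW ?(vs _).1// => v _ /=.
  by rewrite expr0n mul0r.
have yy : ell2 G y.
  have y0 : ell2 G (y \- (s 0%N).1.1)%R by apply/ell2P; exists (s 0%N).1.2.
  have := ell2D Plinear y0 (vs 0%N).2.
  by rewrite (_ : (_ \+ _)%R = y)//; apply/funext => v /=; rewrite subrK.
have [c yc] := (ell2P _ _).1 yy.
have [d d0 dP] := semigroup_cvg0 yy ltr01.
have [n _ /(_ _ (leqnn _)) nd] := near_infty_natSinv_lt (PosNum d0).
(* Past [n] the chosen time is below [d], so [P] moves [y] by at most 1 in [sqnorm] and its image is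
   bounded by [2 * 1 + 2 * c]. Past the second index this contradicts the lower bound [N.+1]. *)
pose N := maxn n (Num.bound (2 * 1 + 2 * c)).
have [_ _ /= /andP[t0 tN] _ low] := FP (N, s N) (vs N).
apply: (low y); first exact: (yP N.+1).
have /sqnormD /(_ yc) : (sqnorm G (P (s N.+1).2 y \- y)%R <= 1%:E)%E.
  apply/ltW/dP => //; rewrite (le_lt_trans tN)// (le_lt_trans _ nd)//.
  by rewrite lef_pV2 ?posrE// ler_nat ltnS leq_maxl.
rewrite (_ : (_ \+ _)%R = P (s N.+1).2 y); last by apply/funext => v /=; rewrite subrK.
move=> /le_trans; apply; rewrite lee_fin.
have c0 : 0 <= c by rewrite -lee_fin (le_trans _ yc) ?sqnorm_ge0.
have c20 : 0 <= 2 * 1 + 2 * c by rewrite addr_ge0 ?mulr_ge0.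
rewrite (le_trans (ltW (archi_boundP c20)))//.
by rewrite ler_nat (leq_trans (leq_maxr n _))// leqW.
Qed.

(** Homogeneity extends the bound from the unit ball, and the semigroup law cuts [[0, T]] into
    pieces of length [delta], each costing a factor [M]. Taking [M >= 1] covers time 0 and makes the
    powers nondecreasing. *)
Lemma semigroup_bounded_interval T : exists2 M, 0 < M &
  forall t f c, 0 <= t -> t <= T -> 0 < c -> (sqnorm G f <= c%:E)%E ->
    (sqnorm G (P t f) <= (M * c)%:E)%E.
Proof.
have [delta [M0 [d0 M00 M0P]]] := semigroup_bounded_near0.
have P0f f : ell2 G f -> P 0 f = f by case: hP => _ /(_ f).
have PD s t f : 0 <= s -> 0 <= t -> ell2 G f -> P (s + t) f = P s (P t f).
  by case: hP => _ _ /(_ s t f).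
pose M := Num.max 1 M0.
have M1 : 1 <= M by rewrite le_max lexx.
have Mpos : 0 < M by rewrite (lt_le_trans ltr01).
have near0 t f c : 0 <= t -> t <= delta -> 0 < c -> (sqnorm G f <= c%:E)%E ->
    (sqnorm G (P t f) <= (M * c)%:E)%E.
  move=> t0 td c0 fc; have ff : ell2 G f by apply/ell2P; exists c.
  move: t0; rewrite le_eqVlt => /predU1P[<-|t0].
    by rewrite P0f// (le_trans fc)// lee_fin ler_peMl// ltW.
  pose k := (Num.sqrt c)^-1.
  have k2 : k ^+ 2 = c^-1 by rewrite exprVn sqr_sqrtr// ltW.
  have /(M0P _ _ t0 td) : (sqnorm G (fun x => (k * f x)%R) <= 1)%E.
    by have := sqnormZ k fc; rewrite k2 mulVf ?gt_eqF.
  rewrite (semigroupZ Plinear)//; last exact: ltW.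
  move=> /(sqnormZ k^-1); rewrite exprVn k2 (invrK c).
  rewrite (_ : (fun x => _) = P t f); last first.
    by apply/funext => x /=; rewrite mulKf// invr_eq0 gt_eqF ?sqrtr_gt0.
  by move=> /le_trans; apply; rewrite lee_fin mulrC ler_wpM2r ?(ltW c0)// le_max lexx orbT.
have bn n t f c : 0 <= t -> t <= n%:R * delta -> 0 < c -> (sqnorm G f <= c%:E)%E ->
    (sqnorm G (P t f) <= (M ^+ n * c)%:E)%E.
  elim: n t => [|n IH] t t0 tn c0 fc.
    by rewrite expr0 mul1r; move: tn; rewrite mul0r => t00;
      rewrite (_ : t = 0) ?P0f//; [apply/ell2P; exists c|apply/eqP; rewrite eq_le t00].
  have [td|td] := leP t delta.
    rewrite (le_trans (near0 _ _ _ t0 td c0 fc))// lee_fin exprS -mulrA.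
    by rewrite ler_wpM2l ?(ltW Mpos)// ler_peMl ?(ltW c0)// exprn_ege1.
  have -> : t = delta + (t - delta) by rewrite addrC subrK.
  have td0 : 0 <= t - delta by rewrite subr_ge0 ltW.
  rewrite PD ?(ltW d0)//; last by apply/ell2P; exists c.
  rewrite exprS -mulrA; apply: near0; [exact: ltW|exact: lexx|by rewrite mulr_gt0 ?exprn_gt0|].
  by apply: IH => //; move: tn; rewrite -natr1; lra.
exists (M ^+ Num.bound (T / delta)); first by rewrite exprn_gt0.
move=> t f c t0 tT; apply: bn => //; rewrite (le_trans tT)// -ler_pdivrMr// ltW//.
by rewrite archi_boundP// divr_ge0 ?(ltW d0)// (le_trans t0).
Qed.

End uniform_boundedness_interval.

(** Walk along the grid of step [d], collecting the exceptional set of each grid point. Between grid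
    points, comparison with the left one gives [2 * (e / 4) + e / 2 = e]. *)
Lemma uniform_tail (R : realType) (V : choiceType) (Q : R -> V -> R) (T e d : R) :
  0 < d ->
  (forall t, 0 <= t <= T -> exists F : seq V, forall x, x \notin F -> Q t x <= e / 4) ->
  (forall s t, 0 <= s -> s <= t -> t <= T -> t - s < d ->
     forall x, Q t x <= 2 * Q s x + e / 2) ->
  exists F : seq V, forall t, 0 <= t <= T -> forall x, x \notin F -> Q t x <= e.
Proof.
move=> d0 Qtail Qd.
have step n : exists F : seq V, forall t, 0 <= t <= T -> t < n%:R * d ->
    forall x, x \notin F -> Q t x <= e.
  elim: n => [|n [F FP]].
    by exists [::] => t /andP[t0 _]; rewrite mul0r ltNge t0.
  have [nT|Tn] := leP (n%:R * d) T; last first.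
    by exists F => t t0T _; apply: FP => //; case/andP: t0T => _ /le_lt_trans; exact.
  have n0 : 0 <= n%:R * d by rewrite mulr_ge0// ltW.
  have [|F' F'P] := Qtail (n%:R * d); first by rewrite n0.
  exists (F ++ F') => t /andP[t0 tT] tn x; rewrite mem_cat negb_or => /andP[xF xF'].
  have [nt|tn'] := leP (n%:R * d) t; last by apply: FP => //; rewrite t0.
  have td : t - n%:R * d < d by move: tn; rewrite -natr1; lra.
  by have := Qd _ _ n0 nt tT td x; have := F'P x xF'; lra.
have [F FP] := step (Num.bound (T / d)); exists F => t t0T; apply: FP => //.
case/andP: t0T => t0 tT; rewrite (le_lt_trans tT)// -ltr_pdivrMr//.
by rewrite archi_boundP// divr_ge0 ?(ltW d0)// (le_trans t0).
Qed.

(** * Continuity and differentiability of the heat flow in norm *)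

Section heat_flow.
Variables (R : realType) (V : choiceType) (G : weighted_graph R V).
Variables (L : operator R V) (P : R -> (V -> R) -> V -> R).
Hypothesis hL : dirichlet_generator G L.
Hypothesis hP : exp_semigroup G L P.
Implicit Types (f g : V -> R).

Let Plinear t (t0 : 0 <= t) : linear_operator G (Operator (ell2 G) (P t)).
Proof. by case: hP => /(_ t t0)[]. Qed.

Lemma semigroup0 f : ell2 G f -> P 0 f = f.
Proof. by case: hP => _ /(_ f). Qed.

Lemma semigroupD s t f : 0 <= s -> 0 <= t -> ell2 G f -> P (s + t) f = P s (P t f).
Proof. by case: hP => _ _ /(_ s t f). Qed.

Lemma generator_ell2 f : dom L f -> ell2 G f.
Proof. by case: hL => -[[+ _ _ _] _ _] _ _ => /[apply]. Qed.

Lemma generator_act_ell2 f : dom L f -> ell2 G (act L f).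
Proof. by case: hL => -[[_ + _ _] _ _] _ _ => /[apply]. Qed.

(** Write [P t f - P s f] as [P s (P (t - s) f - f)]. Continuity at 0 with tolerance [e / M]
    suffices, [M] being the bound on [[0, T]]. *)
Lemma semigroup_unif_cont f T e : ell2 G f -> 0 < e ->
  exists2 d, 0 < d & forall s t, 0 <= s -> s <= t -> t <= T -> t - s < d ->
    (sqnorm G (P t f \- P s f)%R <= e%:E)%E.
Proof.
move=> ff e0; have [M M0 MP] := semigroup_bounded_interval hP T.
have eM0 : 0 < e / M by rewrite divr_gt0.
have [d d0 dP] := semigroup_cvg0 hP ff eM0.
exists d => // s t s0; rewrite le_eqVlt => /predU1P[<- _ _|st tT tsd].
  rewrite (_ : (_ \- _)%R = (fun x => 0 * f x)); last first.
    by apply/funext => x /=; rewrite subrr mul0r.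
  have [c fc] := (ell2P _ _).1 ff.
  by rewrite (le_trans (sqnormZ 0 fc))// expr0n/= mul0r lee_fin ltW.
have ts0 : 0 < t - s by rewrite subr_gt0.
have {1}-> : t = s + (t - s) by rewrite addrC subrK.
rewrite semigroupD ?(ltW ts0)// -(semigroupB Plinear)//; last first.
  by apply: (semigroup_ell2 Plinear) => //; exact: ltW.
rewrite -(divfK (lt0r_neq0 M0) e) mulrC.
apply: MP => //; first by rewrite (le_trans (ltW st)).
exact/ltW/dP.
Qed.

Definition diff_quotient t f : V -> R := fun x => t^-1 * (P t f x - f x).

Lemma diff_quotient_cvg f e : dom L f -> 0 < e ->
  exists2 d, 0 < d & forall t, 0 < t -> t < d ->
    (sqnorm G (diff_quotient t f \- act L f)%R < e%:E)%E.
Proof.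
move=> Lf e0.
case: hP => _ _ _ _ /(_ f _ (generator_ell2 Lf) (generator_act_ell2 Lf)) [_ /(_ (conj Lf erefl))].
move=> /cvge0_lt /(_ e0)[d /= d0 dP]; exists d => // t t0 td.
by apply: dP => //=; rewrite sub0r normrN gtr0_norm.
Qed.

Lemma semigroup_diff_quotient s t f : 0 <= s -> 0 < t -> dom L f ->
  P s (diff_quotient t f \- act L f) =
  (fun x => t^-1 * (P (s + t) f x - P s f x) - P s (act L f) x).
Proof.
move=> s0 t0 Lf; have ff := generator_ell2 Lf.
have Pf : ell2 G (P t f) by apply: (semigroup_ell2 Plinear) => //; exact: ltW.
have Df := ell2B Plinear Pf ff.
rewrite (semigroupB Plinear)//; last 2 first.
- have [c hc] := (ell2P _ _).1 Df.
  by apply/ell2P; exists (t^-1 ^+ 2 * c); exact: sqnormZ.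
- exact: generator_act_ell2.
rewrite (semigroupZ Plinear t^-1 s0 Df) (semigroupB Plinear)//.
by rewrite semigroupD// ltW.
Qed.

(** [P s] commutes with difference quotients and is bounded, so the quotients of [P s f] converge to
    [P s (act L f)]; the semigroup's characterisation of [L] concludes. *)
Lemma generator_semigroup s f : 0 <= s -> dom L f ->
  dom L (P s f) /\ act L (P s f) = P s (act L f).
Proof.
move=> s0 Lf; have ff := generator_ell2 Lf; have Lff := generator_act_ell2 Lf.
have PE t : ell2 G f -> 0 <= t -> P t (P s f) = P (s + t) f.
  by move=> _ t0; rewrite addrC semigroupD.
case: hP => _ _ _ _ /(_ (P s f) (P s (act L f))) [| | + _].
- exact: (semigroup_ell2 Plinear).
- exact: (semigroup_ell2 Plinear).
apply; apply: cvge0 => [t|e e0]; first exact: sqnorm_ge0.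
have [M M0 MP] := semigroup_bounded_interval hP s.
have eM0 : 0 < e / M by rewrite divr_gt0.
have [d d0 dP] := diff_quotient_cvg Lf eM0.
exists d => //= t; rewrite /= sub0r normrN => td t0.
rewrite PE ?(ltW t0)// -semigroup_diff_quotient//.
rewrite -(divfK (lt0r_neq0 M0) e) mulrC; apply: MP => //.
by apply/ltW/dP => //; rewrite -(gtr0_norm t0).
Qed.

(** For [k > 0] the quotient is the image under [P t] of a quotient at time 0. For [k < 0] it is
    such an image under [P (t + k)], corrected by the continuity of [s |-> P s (act L f)]. Requiring
    [d <= t] keeps [t + k] nonnegative. *)
Lemma semigroup_diff f t e : dom L f -> 0 < t -> 0 < e ->
  exists2 d, 0 < d & forall k, k != 0 -> `|k| < d ->
    (sqnorm G (fun x => (k^-1 * (P `|t + k| f x - P t f x) - P t (act L f) x)%R)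
      <= e%:E)%E.
Proof.
move=> Lf t0 e0; have [M M0 MP] := semigroup_bounded_interval hP t.
have eM0 : 0 < e / 4 / M by rewrite !divr_gt0.
have e40 : 0 < e / 4 by rewrite divr_gt0.
have [d1 d10 d1P] := diff_quotient_cvg Lf eM0.
have [d2 d20 d2P] := semigroup_unif_cont t (generator_act_ell2 Lf) e40.
have Pdq s j : 0 <= s -> s <= t -> 0 < j -> j < d1 ->
    (sqnorm G (P s (diff_quotient j f \- act L f)%R) <= (e / 4)%:E)%E.
  move=> s0 st j0 jd; rewrite -(divfK (lt0r_neq0 M0) (e / 4)) mulrC.
  by apply: MP => //; exact/ltW/d1P.
exists (Num.min t (Num.min d1 d2)); first by rewrite !lt_min t0 d10.
move=> k k0; rewrite !lt_min => /and3P[kt kd1 kd2].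
have [kneg|kpos|k00] := ltgtP k 0; last by rewrite k00 eqxx in k0.
- have j0 : 0 < - k by rewrite oppr_gt0.
  move: kt kd1 kd2; rewrite ltr0_norm// => kt kd1 kd2.
  have s0 : 0 <= t + k by lra.
  rewrite ger0_norm//.
  have hd : (sqnorm G (P t (act L f) \- P (t + k) (act L f))%R <= (e / 4)%:E)%E.
    by apply: d2P => //; lra.
  have st : t + k <= t by lra.
  have := sqnormB (Pdq _ _ s0 st j0 kd1) hd.
  rewrite semigroup_diff_quotient// addrK => /le_trans H.
  rewrite [X in sqnorm G X](_ : _ = (fun x => (- k)^-1 * (P t f x - P (t + k) f x)
      - P (t + k) (act L f) x) \- (P t (act L f) \- P (t + k) (act L f))); last first.
    by apply/funext => x /=; rewrite invrN; ring.
  by apply: H; rewrite lee_fin; lra.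
- rewrite ger0_norm; last by rewrite addr_ge0// ltW.
  rewrite -semigroup_diff_quotient// ?(ltW t0)//.
  apply: le_trans (Pdq _ _ _ _ _ _) _ => //; first exact: ltW.
    by rewrite -(gtr0_norm kpos).
  by rewrite lee_fin; lra.
Qed.

End heat_flow.

(** * One-variable calculus *)

Lemma is_derive_expRM (R : realType) (k t : R) :
  is_derive t 1 (fun s : R => expR (k * s)) (k * expR (k * t)).
Proof.
have lin : is_derive t 1 (fun s : R => k * s) k.
  rewrite (_ : (fun s : R => _) = k *: id)//.
  by apply: is_derive_eq; rewrite /GRing.scale/= mulr1.
by have := is_derive1_comp (is_derive_expR _) lin; rewrite mulrC.
Qed.

Lemma continuous_expRM (R : realType) (k : R) : continuous (fun s : R => expR (k * s)).
Proof.
move=> t; apply: differentiable_continuous; apply/derivable1_diffP.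
by case: (is_derive_expRM k t).
Qed.

Lemma is_derive_left_max (R : realType) (f : R -> R) (t D : R) : 0 < t ->
  is_derive t 1 f D -> (forall s, 0 <= s -> s <= t -> f s <= f t) -> 0 <= D.
Proof.
move=> t0 [fd fD] fmax; rewrite leNgt; apply/negP => D0.
have /cvgrPdist_lt/(_ (- D)) : h^-1 *: (f (h *: 1 + t) - f t) @[h --> 0^'] --> D.
  by rewrite -fD; exact: fd.
rewrite oppr_gt0 => /(_ D0) [d /= d0 dP].
(* A step to the left that is shorter than [d] and does not pass time 0. *)
pose h : R := - Num.min (d / 2) t.
have m0 : 0 < Num.min (d / 2) t by rewrite lt_min t0 divr_gt0.
have md : Num.min (d / 2) t < d by rewrite gt_min; apply/orP; left; lra.
have h0 : h < 0 by rewrite oppr_lt0.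
have := dP h; rewrite /= sub0r normrN ltr0_norm// opprK => /(_ md (ltr0_neq0 h0)).
have : 0 <= h^-1 *: (f (h *: 1 + t) - f t).
  rewrite /GRing.scale/= mulr1 mulr_le0// ?invr_le0 ?(ltW h0)// subr_le0 fmax//.
  - by rewrite addrC subr_ge0 ge_min lexx orbT.
  - by rewrite gerDr ltW.
by move: (h^-1 *: _) => q q0; rewrite ltr0_norm; lra.
Qed.

(** * The parabolic maximum principle *)

Section max_principle.
Variables (R : realType) (V : choiceType) (G : weighted_graph R V).

(** The extreme value theorem is applied in time at each vertex of [s]. Starting the induction at
    [(t1, x1)] makes the maximum at least a prescribed value. *)
Lemma seq_path_max (z : R -> V -> R) (t1 : R) (x1 : V) (s : seq V) : 0 <= t1 ->
  (forall x, continuous (z ^~ x)) ->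
  exists t x, [/\ 0 <= t, t <= t1, z t1 x1 <= z t x &
    forall t', 0 <= t' -> t' <= t1 -> forall y, y \in s -> z t' y <= z t x].
Proof.
move=> t10 zc; elim: s => [|y s [t [x [t0 tt1 z1 IH]]]]; first by exists t1, x1.
have zyc : {within `[0, t1], continuous (z ^~ y)} by exact: continuous_subspaceT.
have [c] := EVT_max t10 zyc.
rewrite in_itv/= => /andP[c0 ct1] cmax.
have [zc'|zc'] := leP (z c y) (z t x).
  exists t, x; split => // t' t'0 t't1 v; rewrite inE => /predU1P[->|]; last exact: IH.
  by rewrite (le_trans _ zc')// cmax// in_itv/= t'0.
exists c, y; split => //; first exact: le_trans (ltW zc').
move=> t' t'0 t't1 v; rewrite inE => /predU1P[->|vs]; first by rewrite cmax// in_itv/= t'0.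
by rewrite (le_trans _ (ltW zc'))// IH.
Qed.

(** Damp [w] by [exp (- (C + 1) t)]. At a positive maximum of the product the Laplacian is
    nonpositive, so the time derivative is at most [- E t * w t x < 0], impossible at a maximum over
    earlier times. *)
Lemma parabolic_max_principle (w : R -> V -> R) (T C : R) : 0 <= C ->
  (forall x, w 0 x <= 0) -> (forall x, continuous (w ^~ x)) ->
  (forall t x, 0 < t -> t <= T -> 0 < w t x ->
    exists2 d, is_derive t 1 (w ^~ x) d & d <= Lap G (w t) x + C * w t x) ->
  (forall e, 0 < e -> exists F : seq V, forall t, 0 <= t <= T ->
    forall x, x \notin F -> w t x <= e) ->
  forall t x, 0 <= t -> t <= T -> w t x <= 0.
Proof.
move=> C0 w0 wc wd wtail t1 x1 t10 t1T; rewrite leNgt; apply/negP => w1.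
pose E (t : R) := expR (- (C + 1) * t).
have Egt0 t : 0 < E t by exact: expR_gt0.
have E1 t : 0 <= t -> E t <= 1.
  by move=> t0; rewrite /E -expR0 ler_expR mulNr oppr_le0 mulr_ge0// addr_ge0.
have dE (t : R) : is_derive t 1 E (- (C + 1) * E t) by exact: is_derive_expRM.
have cE : continuous E by exact: continuous_expRM.
pose z t x := E t * w t x.
have zc x : continuous (z ^~ x) by move=> t; apply: continuousM; [exact: cE|exact: wc].
have z1 : 0 < z t1 x1 by rewrite mulr_gt0.
(* Off [F], [z] stays below half of [z t1 x1] since [E <= 1]; a maximum over [F] that is at least
   [z t1 x1] is therefore global. *)
have [F FP] := wtail _ (divr_gt0 z1 (ltr0n _ 2)).
have [t [x [t0 tt1 z1tx smax]]] := seq_path_max x1 F t10 zc.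
have ztx : 0 < z t x by rewrite (lt_le_trans z1).
have zmax t' y : 0 <= t' -> t' <= t1 -> z t' y <= z t x.
  move=> t'0 t't1; have [/smax->//|yF] := boolP (y \in F).
  have t'T : 0 <= t' <= T by rewrite t'0 (le_trans t't1).
  have := FP _ t'T _ yF => /(ler_wpM2l (ltW (Egt0 t')))/le_trans; apply.
  apply: (@le_trans _ _ (z t1 x1 / 2)); last by lra.
  by rewrite ler_piMl ?E1// divr_ge0// ltW.
have wtx : 0 < w t x by rewrite -(pmulr_rgt0 _ (Egt0 t)).
have tpos : 0 < t.
  rewrite lt_neqAle t0 andbT; apply/eqP => t00.
  by move: wtx; rewrite -t00 ltNge w0.
have [d wdt dle] := wd _ _ tpos (le_trans tt1 t1T) wtx.
have Lle0 : Lap G (w t) x <= 0.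
  by apply: Lap_le0_max => y; rewrite -(ler_pM2l (Egt0 t)); exact: zmax.
have zd : is_derive t 1 (z ^~ x) (E t * d + w t x * (- (C + 1) * E t)).
  have -> : z ^~ x = E * (w ^~ x) by [].
  by apply: is_derive_eq.
have : 0 <= E t * d + w t x * (- (C + 1) * E t).
  apply: (is_derive_left_max tpos zd) => s s0 st; apply: zmax => //.
  exact: le_trans tt1.
apply/negP; rewrite -ltNge.
rewrite (_ : _ + _ = E t * (d - (C + 1) * w t x)); last by ring.
by rewrite pmulr_rlt0//; lra.
Qed.

End max_principle.

Lemma norm_le_sqrM (R : realType) (p e a : R) : 0 <= e -> 0 < a ->
  p ^+ 2 * a <= e ^+ 2 * a -> `|p| <= e.
Proof.
move=> e0 a0; rewrite ler_pM2r// => pe.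
by rewrite -sqrtr_sqr -[leRHS](ger0_norm e0) -(sqrtr_sqr e) ler_sqrt ?sqr_ge0.
Qed.

(** * Pointwise heat flow and tails uniform in time *)

Section pointwise_heat_flow.
Variables (R : realType) (V : choiceType) (G : weighted_graph R V).
Variables (L : operator R V) (P : R -> (V -> R) -> V -> R).
Hypothesis hL : dirichlet_generator G L.
Hypothesis hP : exp_semigroup G L P.
Implicit Types (f g : V -> R).

Let Plinear t (t0 : 0 <= t) : linear_operator G (Operator (ell2 G) (P t)).
Proof. by case: hP => /(_ t t0)[]. Qed.

Lemma sqnorm_point f x e : 0 <= e -> (sqnorm G f <= (e ^+ 2 * m G x)%:E)%E -> `|f x| <= e.
Proof.
move=> e0 /(le_term_esum x (sqrm_ge0 G f)); exact: norm_le_sqrM (m_gt0 G x).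
Qed.

Lemma sqnorm_point_gt0 x e : 0 < e -> 0 < e ^+ 2 * m G x.
Proof. by move=> e0; rewrite mulr_gt0 ?exprn_gt0 ?m_gt0. Qed.

(* Precomposing with the absolute value turns the semigroup, defined for
   nonnegative times, into a path that is continuous on the whole line. *)
Lemma heat_path_continuous f x : ell2 G f -> continuous (fun t : R => P `|t| f x).
Proof.
move=> ff t; apply/cvgrPdist_le => e e0.
have [d d0 dP] := semigroup_unif_cont hP (`|t| + 1) ff (sqnorm_point_gt0 x e0).
have pt s s' : `|s| <= `|s'| -> `|s'| <= `|t| + 1 -> `|s'| - `|s| < d ->
    `|P `|s'| f x - P `|s| f x| <= e.
  move=> ss' s't ss'd; apply: (@sqnorm_point (P `|s'| f \- P `|s| f) x e (ltW e0)).
  exact: dP.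
exists (Num.min d 1); first by rewrite /= lt_min d0/=.
move=> s /=; rewrite lt_min => /andP[sd s1].
have := ler_dist_dist t s; rewrite ler_distl => /andP[h1 h2].
have [st|ts] := leP `|s| `|t|.
  by apply: pt => //; rewrite ?lerDl//; lra.
by rewrite distrC; apply: pt => //; rewrite ?(ltW ts)//; lra.
Qed.

Lemma heat_path_is_derive f x (t : R) : dom L f -> 0 < t ->
  is_derive t 1 (fun s : R => P `|s| f x) (P t (act L f) x).
Proof.
move=> Lf t0.
have : h^-1 *: (P `|h *: 1 + t| f x - P `|t| f x) @[h --> 0^'] --> P t (act L f) x.
  apply/cvgrPdist_le => e e0.
  have [d d0 dP] := semigroup_diff hL hP Lf t0 (sqnorm_point_gt0 x e0).
  exists d => //= h; rewrite /= sub0r normrN => hd h0.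
  rewrite /GRing.scale/= mulr1 (gtr0_norm t0) distrC (addrC h).
  exact: (sqnorm_point (ltW e0) (dP h h0 hd)).
by move=> q; apply: DeriveDef; [apply/cvg_ex; exists (P t (act L f) x)|exact/cvg_lim].
Qed.

Lemma heat_generatorE f t : 0 <= t -> dom L f -> P t (act L f) = Lap G (P t f).
Proof.
by move=> t0 Lf; have [Lt <-] := generator_semigroup hL hP t0 Lf; rewrite (generatorE hL).
Qed.

Lemma semigroup_tail f T e : ell2 G f -> 0 < e -> exists F : seq V,
  forall t, 0 <= t <= T -> forall x, x \notin F -> P t f x ^+ 2 * m G x <= e.
Proof.
move=> ff e0; have e4 : 0 < e / 4 by rewrite divr_gt0.
have [d d0 dP] := semigroup_unif_cont hP T ff e4.
apply: (@uniform_tail _ _ (fun t x => P t f x ^+ 2 * m G x) T e d d0) => [t /andP[t0 _]|].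
  have [c Pc] := (ell2P _ _).1 (semigroup_ell2 Plinear t0 ff).
  exact: esum_tail (sqrm_ge0 G _) Pc e4.
move=> s t s0 st tT tsd x.
have := le_term_esum x (sqrm_ge0 G _) (dP s t s0 st tT tsd).
have := mulr_ge0 (sqr_ge0 (P t f x - 2 * P s f x)) (m_ge0 G x).
by rewrite /= !expr2; lra.
Qed.

(** Since [P t] commutes with [L], both [P t f] and [L (P t f)] are uniformly continuous in norm. By
    [generator_energy] the energy of [P t f - P s f] is then at most [e / 4], and [Gam_split] gives
    the comparison required by [uniform_tail]. *)
Lemma Gam_semigroup_tail f T e : dom L f -> 0 < e -> exists F : seq V,
  forall t, 0 <= t <= T -> forall x, x \notin F ->
  Gam G (P t f) (P t f) x * m G x <= e.
Proof.
move=> Lf e0; have e4 : 0 < e / 4 by rewrite divr_gt0.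
have ff := generator_ell2 hL Lf; have Lff := generator_act_ell2 hL Lf.
have [d1 d10 d1P] := semigroup_unif_cont hP T ff e4.
have [d2 d20 d2P] := semigroup_unif_cont hP T Lff e4.
have Gm g x : 0 <= Gam G g g x * m G x by rewrite mulr_ge0 ?Gam_ge0 ?m_ge0.
apply: (@uniform_tail _ _ (fun t x => Gam G (P t f) (P t f) x * m G x) T e (Num.min d1 d2)).
- by rewrite lt_min d10.
- move=> t /andP[t0 _]; have [LPf _] := generator_semigroup hL hP t0 Lf.
  have [a Pa] := (ell2P _ _).1 (semigroup_ell2 Plinear t0 ff).
  have [b Pb] := (ell2P _ _).1 (semigroup_ell2 Plinear t0 Lff).
  rewrite (heat_generatorE t0 Lf) in Pb.
  exact: esum_tail (Gm _) (generator_energy hL LPf Pa Pb) e4.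
move=> s t s0 st tT; rewrite lt_min => /andP[td1 td2] x.
have t0 : 0 <= t by exact: le_trans st.
have Pst := d1P _ _ s0 st tT td1; have Lst := d2P _ _ s0 st tT td2.
have [LPt _] := generator_semigroup hL hP t0 Lf.
have [LPs _] := generator_semigroup hL hP s0 Lf.
have LPst : dom L (P t f \- P s f)%R.
  case: hL => -[[_ _ _ lin] _ _] _ _; have [+ _] := lin (-1) _ _ LPs LPt.
  by rewrite (_ : (fun x => _) = P t f \- P s f)//; apply/funext => y; rewrite mulN1r addrC.
have LapE' : Lap G (P t f \- P s f)%R = (P t (act L f) \- P s (act L f))%R.
  apply/funext => y; rewrite !heat_generatorE//=.
  rewrite (_ : (P t f \- P s f) = (fun x => -1 * P s f x + P t f x)).
    by rewrite Lap_linear mulN1r addrC.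
  by apply/funext => z; rewrite mulN1r addrC.
rewrite -LapE' in Lst.
have := le_term_esum x (Gm _) (generator_energy hL LPst Pst Lst).
by have := ler_wpM2r (m_ge0 G x) (Gam_split G (P t f) (P s f) x); lra.
Qed.

End pointwise_heat_flow.

(** * Time derivative of Gamma, and the lower bound on the measure *)

Lemma is_derive_sum_seq (R : realType) (I : Type) (r : seq I) (F : I -> R -> R)
  (dF : I -> R) (t : R) : (forall i, is_derive t 1 (F i) (dF i)) ->
  is_derive t 1 (fun s => \sum_(i <- r) F i s) (\sum_(i <- r) dF i).
Proof.
move=> FdF; elim: r => [|i r IH].
  rewrite big_nil (_ : (fun s => _) = cst 0); last by apply/funext => s; rewrite big_nil.
  exact: is_derive_cst.
rewrite big_cons (_ : (fun s => _) = F i + (fun s => \sum_(i <- r) F i s)).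
  exact: is_deriveD.
by apply/funext => s; rewrite big_cons.
Qed.

Lemma is_derive_Gam (R : realType) (V : choiceType) (G : weighted_graph R V)
  (u : R -> V -> R) (v : V -> R) (t : R) y :
  (forall z, is_derive t 1 (u ^~ z) (v z)) ->
  is_derive t 1 (fun s => Gam G (u s) (u s) y) (2 * Gam G (u t) v y).
Proof.
move=> du; rewrite (_ : (fun s => _) = (2^-1 * (m G y)^-1) *: (fun s =>
    \sum_(z <- nbs G y) mu G y z * ((u s z - u s y) * (u s z - u s y)))); last first.
  by apply/funext => s; rewrite GamE.
rewrite GamE mulrCA; apply: is_deriveZ.
rewrite mulr_sumr; apply: is_derive_sum_seq => z.
have dz : is_derive t 1 (fun s => u s z - u s y) (v z - v y) by exact: is_deriveB.
apply: (is_derive_eq (is_deriveZ (mu G y z) (is_deriveM dz dz))).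
by rewrite /GRing.scale/=; ring.
Qed.

Lemma nondegenerate_lbound (R : realType) (V : choiceType) (G : weighted_graph R V) :
  nondegenerate_measure G -> exists2 c, 0 < c & forall x, c <= m G x.
Proof.
rewrite /nondegenerate_measure; set i := ereal_inf _ => i0.
have im x : (i <= (m G x)%:E)%E by apply: ereal_inf_lbound; exists x.
(* The infimum is [+oo] only for empty [V], where any constant works. *)
case: i i0 im => [c|_ im|//]; last by exists 1 => // x; have := im x; rewrite leye_eq.
by rewrite lte_fin => c0 im; exists c => // x; rewrite -lee_fin.
Qed.

(** * Positivity, gradient bound and stochastic completeness *)

Section stochastic_completeness.
Variables (R : realType) (V : choiceType) (G : weighted_graph R V).
Variables (L : operator R V) (P : R -> (V -> R) -> V -> R).
Hypothesis hL : dirichlet_generator G L.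
Hypothesis hP : exp_semigroup G L P.
Hypothesis mnondeg : nondegenerate_measure G.
Implicit Types (f g : V -> R).

Let Plinear t (t0 : 0 <= t) : linear_operator G (Operator (ell2 G) (P t)).
Proof. by case: hP => /(_ t t0)[]. Qed.

(** The maximum principle applies to [- P s f] with [C = 0]. The bound [m >= c] turns the norm tail
    [e^2 * c] into the pointwise tail [e]. *)
Lemma heat_ge0 f t x : dom L f -> (forall y, 0 <= f y) -> 0 <= t -> 0 <= P t f x.
Proof.
move=> Lf f0 t0; have ff := generator_ell2 hL Lf.
have [c c0 cm] := nondegenerate_lbound mnondeg.
have H : forall s y, 0 <= s -> s <= t -> - P `|s| f y <= 0.
  apply: (parabolic_max_principle (G := G) (C := 0)) => //.
  - by move=> y; rewrite normr0 (semigroup0 hP)// oppr_le0.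
  - by move=> y s; apply: continuousN; exact: (heat_path_continuous hP ff).
  - move=> s y s0 _ _; exists (- P s (act L f) y).
      exact: (is_deriveN (heat_path_is_derive hL hP y Lf s0)).
    rewrite mul0r addr0 (heat_generatorE hL hP (ltW s0) Lf) (gtr0_norm s0).
    by rewrite LapN.
  - move=> e e0; have [F FP] := semigroup_tail hP t ff (mulr_gt0 (exprn_gt0 2 e0) c0).
    exists F => s s0t y /(FP _ s0t y) Pe; case/andP: s0t => s0 _.
    rewrite ger0_norm// (le_trans (ler_norm _))// normrN.
    apply: (norm_le_sqrM (ltW e0) (m_gt0 G y)).
    by rewrite (le_trans Pe)// ler_wpM2l// sqr_ge0.
by have := H t x t0 (lexx _); rewrite ger0_norm// oppr_le0.
Qed.

Lemma heat_indic_ge0 t x y : 0 <= t -> 0 <= P t \1_[set y] x.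
Proof.
have ind0 z : 0 <= \1_[set y] z :> R by rewrite indic1E ler0n.
exact: (heat_ge0 x (generator_dom_indic hL y) ind0).
Qed.

(** The barrier [b = B * expR (k * s)] solves [b' = k b]. With [- 2 K <= k], the curvature condition
    makes the difference [w] satisfy the differential inequality with [C = k]. *)
Lemma heat_Gam_le f B K t x : CD G K -> dom L f -> 0 <= B ->
  (forall y, Gam G f f y <= B) -> 0 <= t ->
  Gam G (P t f) (P t f) x <= B * expR (2 * `|K| * t).
Proof.
move=> GCD Lf B0 fB t0; have ff := generator_ell2 hL Lf.
have [c c0 cm] := nondegenerate_lbound mnondeg.
pose k := 2 * `|K|; have k0 : 0 <= k by rewrite mulr_ge0.
pose u (s : R) := P `|s| f.
pose w (s : R) y := Gam G (u s) (u s) y - B * expR (k * s).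
have H : forall s y, 0 <= s -> s <= t -> w s y <= 0.
  apply: (parabolic_max_principle (G := G) (C := k)) => //.
  - by move=> y; rewrite /w /u normr0 (semigroup0 hP)// mulr0 expR0 mulr1 subr_le0.
  - move=> y; have cG : continuous (fun s : R => Gam G (u s) (u s) y).
      move=> s; under eq_fun do rewrite GamE.
      apply: cvgM; first exact: cvg_cst.
      apply: cvg_big => [|z _]; first exact: add_continuous.
      by apply: cvgM; [exact: cvg_cst|apply: cvgM; apply: cvgB; exact: (heat_path_continuous hP ff)].
    have cE : continuous (fun s : R => B * expR (k * s)).
      by move=> s; apply: cvgM; [exact: cvg_cst|exact: continuous_expRM].
    by move=> s; exact: (continuousB (cG s) (cE s)).
  - move=> s y s0 _ _.
    exists (2 * Gam G (u s) (Lap G (u s)) y - B * (k * expR (k * s))).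
      have du z : is_derive s 1 (u ^~ z) (Lap G (u s) z).
        have uE : u s = P s f by rewrite /u (gtr0_norm s0).
        rewrite uE -(heat_generatorE hL hP (ltW s0) Lf).
        exact: (heat_path_is_derive hL hP z Lf s0).
      by apply: is_deriveB; [exact: is_derive_Gam|exact: (is_deriveZ B (is_derive_expRM k s))].
    have := GCD (u s) y; rewrite /Gam2.
    (* The barrier is constant in space, so the Laplacian does not see it. *)
    have -> : Lap G (w s) y = Lap G (Gam G (u s) (u s)) y.
      by rewrite !LapE; congr (_ * _); apply: eq_bigr => z _; rewrite /w; ring.
    have := ler_wpM2r (Gam_ge0 G (u s) y) (ler_norm (- K)).
    rewrite /w normrN /k; lra.
  - move=> e e0; have [F FP] := Gam_semigroup_tail hL hP t Lf (mulr_gt0 e0 c0).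
    exists F => s s0t y /(FP _ s0t y) Ge; case/andP: s0t => s0 _.
    rewrite /w /u ger0_norm// (@le_trans _ _ (Gam G (P s f) (P s f) y))//.
      by rewrite gerBl mulr_ge0// expR_ge0.
    by rewrite -(ler_pM2r (m_gt0 G y)) (le_trans Ge)// ler_wpM2l ?(ltW e0).
by have := H t x t0 (lexx _); rewrite /w /u ger0_norm// subr_le0.
Qed.

Lemma dom_semigroup_comb (c : V -> R) (r : seq V) t : 0 <= t ->
  dom L (fun x => \sum_(y <- r) c y * \1_[set y] x) /\
  P t (fun x => \sum_(y <- r) c y * \1_[set y] x) =
    (fun x => \sum_(y <- r) c y * P t \1_[set y] x).
Proof.
move=> t0; elim: r => [|y r [Lr Pr]].
  have L0 : dom L (fun=> 0) by case: hL => -[[_ _ ? _] _ _].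
  rewrite (_ : (fun x : V => _) = (fun=> 0)); last by apply/funext => x; rewrite big_nil.
  split => //; have := semigroupZ Plinear 0 t0 (generator_ell2 hL L0).
  rewrite (_ : (fun x => 0 * _) = (fun=> 0)); last by apply/funext => x; rewrite mul0r.
  by move=> ->; apply/funext => x; rewrite mul0r big_nil.
have L1 := generator_dom_indic hL y.
rewrite (_ : (fun x => _) = (fun x => c y * \1_[set y] x +
    \sum_(y <- r) c y * \1_[set y] x)); last by apply/funext => x; rewrite big_cons.
split; first by case: hL => -[[_ _ _ /(_ (c y) _ _ L1 Lr)[]]].
rewrite (semigroup_lin Plinear (c y) t0 (generator_ell2 hL L1) (generator_ell2 hL Lr)).
by rewrite Pr; apply/funext => x; rewrite big_cons.
Qed.

Lemma indic_decomp f (r : seq V) : uniq r -> (forall x, x \notin r -> f x = 0) ->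
  f = (fun x => \sum_(y <- r) f y * \1_[set y] x).
Proof.
move=> ur fr; apply/funext => x; have [xr|xr] := boolP (x \in r).
  rewrite (bigD1_seq x)//= indic1E eqxx mulr1 big1 ?addr0// => y yx.
  by rewrite indic1E eq_sym (negPf yx) mulr0.
rewrite fr// big_seq big1// => y yr; rewrite indic1E.
by case: eqP => [xy|]; [rewrite xy yr in xr|rewrite mulr0].
Qed.

Lemma generator_dom_finsupp f : finitely_supported f -> dom L f.
Proof.
move=> /finsuppP[r fr]; rewrite (@indic_decomp f (undup r)) ?undup_uniq//.
  exact: (dom_semigroup_comb _ _ (lexx 0)).1.
by move=> x; rewrite mem_undup; exact: fr.
Qed.

Lemma semigroup_decomp f (r : seq V) t x : 0 <= t -> uniq r ->
  (forall x, x \notin r -> f x = 0) ->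
  P t f x = \sum_(y <- r) f y * P t \1_[set y] x.
Proof. by move=> t0 ur fr; rewrite {1}(indic_decomp ur fr) (dom_semigroup_comb _ _ t0).2. Qed.

(** By the mean value theorem [P t (eta k) x - eta k x] is [t] times a Laplacian at an intermediate
    time, which the gradient bound makes small. *)
Lemma heat_cutoff_cvg (eta : nat -> V -> R) K t x : CD G K -> 0 < t ->
  (forall k, finitely_supported (eta k)) ->
  (forall y, eta k y @[k --> \oo] --> (1 : R)) ->
  (forall k y, Gam G (eta k) (eta k) y <= k.+1%:R^-1) ->
  P t (eta k) x @[k --> \oo] --> (1 : R).
Proof.
move=> GCD t0 etaf eta1 etaG.
pose A := expR (2 * `|K| * t); have A0 : 0 < A by exact: expR_gt0.
pose C := t * (half_degree G x + A).
have C0 : 0 <= C by rewrite mulr_ge0 ?addr_ge0 ?half_degree_ge0// ltW.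
have diff k : `|P t (eta k) x - eta k x| <= C * Num.sqrt k.+1%:R^-1.
  have Lf := generator_dom_finsupp (etaf k); have ff := generator_ell2 hL Lf.
  have der s : s \in `]0, t[%R ->
      is_derive s 1 (fun s => P `|s| (eta k) x) (P s (act L (eta k)) x).
    by rewrite in_itv/= => /andP[s0 _]; exact: (heat_path_is_derive hL hP x Lf s0).
  have [|s] := MVT t0 der; first by apply: continuous_subspaceT; exact: (heat_path_continuous hP ff).
  rewrite in_itv/= => /andP[s0 st].
  rewrite normr0 (gtr0_norm t0) (semigroup0 hP)// subr0 => ->.
  rewrite normrM (gtr0_norm t0) mulrC -mulrA ler_wpM2l ?(ltW t0)//.
  rewrite (heat_generatorE hL hP (ltW s0) Lf).
  (* As [Gam] is at most [A * d^2], taking [e = d] in [Lap_le_Gam] makes both of its terms linear in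
     [d]. *)
  set d := Num.sqrt _; have d0 : 0 < d by rewrite sqrtr_gt0 invr_gt0.
  rewrite (le_trans (Lap_le_Gam G _ x d0))// mulrDl (mulrC d) lerD2l.
  rewrite ler_pdivrMl// mulrCA -expr2 sqr_sqrtr ?invr_ge0// mulrC.
  have kk : 0 <= k.+1%:R^-1 :> R by rewrite invr_ge0.
  rewrite (le_trans (heat_Gam_le x GCD Lf kk (etaG k) (ltW s0)))// ler_wpM2l//.
  by rewrite ler_expR ler_wpM2l ?mulr_ge0// ltW.
rewrite (_ : (fun k => _) = (fun k => (P t (eta k) x - eta k x) + eta k x)); last first.
  by apply/funext => k; rewrite subrK.
rewrite -[X in _ --> X]add0r; apply: cvgD => //.
apply/cvgr0Pnorm_le => e e0.
have C1 : 0 < C + 1 by rewrite ltr_wpDl.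
have d0 : 0 < (e / (C + 1)) ^+ 2 by rewrite exprn_gt0 ?divr_gt0.
have := near_infty_natSinv_lt (PosNum d0); apply: filterS => k /= kd.
rewrite (le_trans (diff k))//.
have : Num.sqrt k.+1%:R^-1 <= e / (C + 1).
  by rewrite -[leRHS]gtr0_norm ?divr_gt0// -sqrtr_sqr ler_sqrt ?sqr_ge0// ltW.
rewrite ler_pdivlMr// => /(le_trans _); apply.
by rewrite mulrC ler_wpM2l ?sqrtr_ge0// lerDl.
Qed.

(** Expand [P t (eta k) x] over indicators. Since [eta k <= 1], it is at most the total sum, and its
    limit 1 gives the lower bound. Conversely, a partial sum weighted by [eta k] is at most
    [P t (eta k) x] once the omitted terms are nonnegative. *)
Lemma heat_kernel_sum (eta : nat -> V -> R) K t x : CD G K -> 0 < t ->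
  (forall k, finitely_supported (eta k)) ->
  (forall y, nondecreasing_seq (eta ^~ y)) ->
  (forall y, eta k y @[k --> \oo] --> (1 : R)) ->
  (forall k y, Gam G (eta k) (eta k) y <= k.+1%:R^-1) ->
  (\esum_(y in [set: V]) (P t \1_[set y] x)%:E = 1)%E.
Proof.
move=> GCD t0 etaf etam eta1 etaG.
have etacvg := heat_cutoff_cvg x GCD t0 etaf eta1 etaG.
pose a y := P t \1_[set y] x.
have a0 y : 0 <= a y by exact: (heat_indic_ge0 x y (ltW t0)).
have suppk k := finsuppP (etaf k).
have etale k y : eta k y <= 1.
  rewrite -(cvg_lim (@Rhausdorff R) (eta1 y)).
  by apply: nondecreasing_cvgn_le => //; apply/cvg_ex; exists 1.
have a1 : (\esum_(y in [set: V]) (a y)%:E <= 1%:E)%E.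
  apply: esum_le_fin => r ur.
  have [r0 r0P] := suppk 0%N.
  (* The cutoffs may take negative values, but off the support of [eta 0] monotonicity gives
     [eta k >= eta 0 = 0]. Adding [r0] to [r] leaves only nonnegative terms outside. *)
  pose r' := r ++ [seq y <- undup r0 | y \notin r].
  have ur' : uniq r'.
    rewrite cat_uniq ur filter_uniq ?undup_uniq// andbT.
    by apply/hasPn => y; rewrite mem_filter => /andP[].
  apply: (@le_trans _ _ (\sum_(y <- r') a y)); first by rewrite big_cat lerDl sumr_ge0.
  rewrite -subr_le0; apply: (cvgr_to_le (F := \oo)
    (f := fun k => \sum_(y <- r') eta k y * a y - P t (eta k) x)).
    apply: cvgB etacvg; apply: cvg_big => [|y _]; first exact: add_continuous.
    by rewrite -[X in _ --> X]mul1r; apply: cvgM; [exact: eta1|exact: cvg_cst].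
  exists 0%N => // k _; rewrite subr_le0.
  have [s sP] := suppk k.
  pose s' := r' ++ [seq y <- undup s | y \notin r'].
  rewrite (@semigroup_decomp (eta k) s')//; first last.
  - move=> y; rewrite mem_cat negb_or mem_filter negb_and negbK mem_undup.
    by move=> /andP[yr /orP[/(negP yr)//|/sP]].
  - rewrite cat_uniq ur' filter_uniq ?undup_uniq// andbT.
    by apply/hasPn => y; rewrite mem_filter => /andP[].
  - exact: ltW.
  rewrite [leRHS]big_cat/= lerDl big_filter sumr_ge0// => y yr'; apply: mulr_ge0; last exact: a0.
  rewrite (le_trans _ (etam y 0%N k (leq0n k)))// r0P//.
  apply: contra yr' => yr0; rewrite mem_cat mem_filter mem_undup yr0 andbT.
  by case: (y \in r).
apply/eqP; rewrite eq_le a1/=.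
have Efin : (\esum_(y in [set: V]) (a y)%:E)%E \is a fin_num.
  rewrite ge0_fin_numE ?(le_lt_trans a1) ?ltry//.
  by apply: esum_ge0 => y _; rewrite lee_fin.
rewrite -(fineK Efin) lee_fin.
suff : forall k, P t (eta k) x <= fine (\esum_(y in [set: V]) (a y)%:E)%E.
  by move=> H; apply: (cvgr_to_le etacvg); exists 0%N => // k _; exact: H.
move=> k; have [s sP] := suppk k.
rewrite (@semigroup_decomp (eta k) (undup s)) ?undup_uniq ?(ltW t0)//; last first.
  by move=> y; rewrite mem_undup; exact: sP.
apply: (@le_trans _ _ (\sum_(y <- undup s) a y)).
  by apply: ler_sum => y _; apply: ler_piMl; [exact: a0|exact: etale].
by apply: (sum_le_esum a0); rewrite ?undup_uniq ?fineK.
Qed.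

End stochastic_completeness.

Theorem theorem1p2 (R : realType) (V : choiceType) (G : weighted_graph R V)
    (K : R) (Gcomplete : complete_graph G) (GCD : CD G K)
    (mnondeg : nondegenerate_measure G) :
  stochastically_complete G.
Proof.
move=> P [L hL hP] t t0 x.
have [eta [etaf etam eta1 etaG]] := Gcomplete.
rewrite /heat_extension (_ : (fun y => _) = (fun y => P t \1_[set y] x)); last first.
  by apply/funext => y; rewrite /heat_kernel /= mulr1 mulrAC mulVf ?mul1r// gt_eqF ?m_gt0.
rewrite sumE_ge0E => [|y]; last exact: (heat_indic_ge0 hL hP mnondeg x y (ltW t0)).
exact: (heat_kernel_sum hL hP mnondeg x GCD t0 etaf etam eta1 etaG).
Qed.
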